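(* Let $\phi:\Sigma\to Q=\{x\in\mathbb{R}^{3,3}\mid\langle x,x\rangle=1\}$ be a minimal surface with isotropy of order $2$ (i.e. superconformal or superminimal). Then $h_1=e^{2w_1}$ and $h_2=-e^{2w_2}$ for real functions $w_1,w_2$ (relative to a local holomorphic coordinate $z$), and there is a holomorphic cubic differential $q\,(dz)^3$, with $\langle\phi_3,\phi_3\rangle=-q^2$, such that $$2(w_1)_{z\overline z}=-e^{2w_2-2w_1}-e^{2w_1},$$ $$2(w_2)_{z\overline z}=q\overline q\,e^{-2w_2}+e^{2w_2-2w_1}.$$
   Context: $\mathbb{R}^{3,3}$ is $\mathbb{R}^6$ with a bilinear form $\langle\,,\,\rangle$ of signature $(3,3)$, extended complex bilinearly. $\Sigma$ is a connected oriented surface. A minimal surface $\phi:\Sigma\to Q$ is an immersion sending each tangent space to a positive definite subspace of $\mathbb{R}^{3,3}$ which is harmonic for the induced metric; $\Sigma$ is regarded as a Riemann surface via the induced conformal structure. Subscripts $z,\overline z$ denote partial derivatives with respect to a local holomorphic coordinate $z$. Regard $\phi$ as an $\mathbb{R}^{3,3}$-valued function. Define $\phi_0=\phi$, $\phi_1=\phi_z$ and, as long as $h_i=\langle\phi_i,\overline{\phi_i}\rangle$ is non-vanishing, $$\phi_{i+1}=(\phi_i)_z-\frac{\langle(\phi_i)_z,\overline{\phi_i}\rangle}{h_i}\phi_i .$$ $\phi$ has isotropy of order $2$ if $\phi_0,\dots,\phi_3$ can be constructed (so $h_1,h_2$ are non-vanishing) and $\langle\phi_1,\phi_1\rangle=\langle\phi_2,\phi_2\rangle=0$.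 It is called superminimal if $h_3=\langle\phi_3,\overline{\phi_3}\rangle=0$ and superconformal if $h_3\ne0$. *)

(* Defs.v *)
From HB Require Import structures.
From mathcomp Require Import all_boot all_order all_algebra.
From mathcomp Require Import all_classical all_reals all_analysis.
From mathcomp Require Import complex.

Set Implicit Arguments.
Unset Strict Implicit.
Unset Printing Implicit Defensive.

Import Order.TTheory GRing.Theory Num.Theory.
Import numFieldNormedType.Exports.

Local Open Scope classical_set_scope.
Local Open Scope ring_scope.
Local Open Scope complex_scope.

(* A point p = (x, y) of 'rV[R]_2 stands for z = x + iy. *)
Definition toC (R : realType) (p : 'rV[R]_2) : R[i] := p 0 0 +i* p 0 1.

Definition ofC (R : realType) (z : R[i]) : 'rV[R]_2 :=
  \row_(k < 2) (if k == 0 then complex.Re z else complex.Im z).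

Definition partial (R : realType) (W : normedModType R) (k : 'I_2)
    (f : 'rV[R]_2 -> W) : 'rV[R]_2 -> W :=
  fun p => 'D_(delta_mx 0 k) f p.

(* The class C^k on V, which is open whenever this is used, so that the
   derivatives at points of V only depend on the restriction of f to V. *)
Fixpoint Ck (R : realType) (W : normedModType R) (k : nat)
    (V : set 'rV[R]_2) (f : 'rV[R]_2 -> W) : Prop :=
  match k with
  | 0 => forall p, V p -> {for p, continuous f}
  | k'.+1 => (forall p, V p -> differentiable f p) /\
             (forall j : 'I_2, Ck k' V (partial j f))
  end.

Definition smooth_on (R : realType) (W : normedModType R)
    (V : set 'rV[R]_2) (f : 'rV[R]_2 -> W) : Prop :=
  forall k, Ck k V f.

(* R[i] is not a normed space over R in the library, so real partial derivatives
   of complex-valued functions are taken on real and imaginary parts. *)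
Definition partialC (R : realType) (k : 'I_2) (f : 'rV[R]_2 -> R[i]) :
    'rV[R]_2 -> R[i] :=
  fun p => partial k (fun x => complex.Re (f x)) p +i*
           partial k (fun x => complex.Im (f x)) p.

Definition dz (R : realType) (f : 'rV[R]_2 -> R[i]) : 'rV[R]_2 -> R[i] :=
  fun p => (partialC 0 f p - 'i * partialC 1 f p) / 2%:R.

Definition dzbar (R : realType) (f : 'rV[R]_2 -> R[i]) : 'rV[R]_2 -> R[i] :=
  fun p => (partialC 0 f p + 'i * partialC 1 f p) / 2%:R.

Definition dz_vec (R : realType) (n : nat) (F : 'rV[R]_2 -> 'rV[R[i]]_n) :
    'rV[R]_2 -> 'rV[R[i]]_n :=
  fun p => \row_(k < n) dz (fun x => F x 0 k) p.

Definition holomorphic_on (R : realType) (V : set 'rV[R]_2)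
    (f : 'rV[R]_2 -> R[i]) : Prop :=
  forall p, V p ->
    @derivable R[i] R[i]^o R[i]^o (fun z => f (ofC z)) (toC p) 1.

(* The values of [chart_map] outside [chart_dom], and of [chart_inv] outside the
   image [chart_map @` chart_dom], are irrelevant. *)
Record chart (R : realType) (M : topologicalType) := Chart {
  chart_dom : set M;
  chart_map : M -> 'rV[R]_2;
  chart_inv : 'rV[R]_2 -> M;
  chart_dom_open : open chart_dom;
  chart_im_open : open (chart_map @` chart_dom);
  chart_mapK : forall x, chart_dom x -> chart_inv (chart_map x) = x;
  chart_map_cont : {within chart_dom, continuous chart_map};
  chart_inv_cont : {within chart_map @` chart_dom, continuous chart_inv}
}.

Definition chart_im (R : realType) (M : topologicalType) (c : chart R M) :
    set 'rV[R]_2 :=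
  chart_map c @` chart_dom c.

Definition transition (R : realType) (M : topologicalType) (c c' : chart R M) :
    'rV[R]_2 -> 'rV[R]_2 :=
  chart_map c' \o chart_inv c.

Definition overlap (R : realType) (M : topologicalType) (c c' : chart R M) :
    set 'rV[R]_2 :=
  chart_map c @` (chart_dom c `&` chart_dom c').

Definition oriented_compatible (R : realType) (M : topologicalType)
    (c c' : chart R M) : Prop :=
  smooth_on (overlap c c') (transition c c') /\
  (forall p, overlap c c' p -> 0 < \det ('J (transition c c') p)).

(* A connected oriented surface; the oriented smooth structure is given by its
   maximal atlas, i.e. [atlas] is the set of all oriented local coordinates. *)
Record orientedSurface (R : realType) := OrientedSurface {
  carrier :> topologicalType;
  atlas : set (chart R carrier);
  surface_hausdorff : hausdorff_space carrier;
  surface_countable : @second_countable carrier;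
  surface_connected : connected [set: carrier];
  atlas_cover : forall x, exists2 c, atlas c & chart_dom c x;
  atlas_compatible : forall c c', atlas c -> atlas c' ->
    oriented_compatible c c';
  atlas_maximal : forall c,
    (forall c', atlas c' -> oriented_compatible c c' /\ oriented_compatible c' c)
    -> atlas c
}.

Definition bilin (K : comNzRingType) (n : nat) (B : 'M[K]_n) (x y : 'rV[K]_n) : K :=
  (x *m B *m y^T) 0 0.

(* B is the Gram matrix of a symmetric bilinear form of signature (3, 3). *)
Definition signature33 (R : realType) (B : 'M[R]_6) : Prop :=
  exists2 P : 'M[R]_6, P \in unitmx &
    P *m B *m P^T = diag_mx (\row_(k < 6) (if (k < 3)%N then 1 else -1)).

Definition toCmx (R : realType) (m n : nat) (A : 'M[R]_(m, n)) : 'M[R[i]]_(m, n) :=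
  map_mx (real_complex R) A.

Definition conjv (R : realType) (n : nat) (x : 'rV[R[i]]_n) : 'rV[R[i]]_n :=
  map_mx (@conjc R) x.

Definition bilinC (R : realType) (n : nat) (B : 'M[R]_n) (x y : 'rV[R[i]]_n) : R[i] :=
  bilin (toCmx B) x y.

Definition quadric (R : realType) (B : 'M[R]_6) : set 'rV[R]_6 :=
  [set x | bilin B x x = 1].

Definition local_rep (R : realType) (S : orientedSurface R)
    (phi : S -> 'rV[R]_6) (c : chart R S) : 'rV[R]_2 -> 'rV[R]_6 :=
  phi \o chart_inv c.

(* Row k of 'J F p is the k-th partial derivative of F at p. *)
Definition induced_metric (R : realType) (B : 'M[R]_6)
    (F : 'rV[R]_2 -> 'rV[R]_6) (p : 'rV[R]_2) : 'M[R]_2 :=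
  'J F p *m B *m ('J F p)^T.

(* The Laplace-Beltrami operator of the metric g,
   (1 / sqrt (det g)) d_j (sqrt (det g) g^(jk) d_k F). *)
Definition laplace_beltrami (R : realType) (W : normedModType R)
    (g : 'rV[R]_2 -> 'M[R]_2) (F : 'rV[R]_2 -> W) (p : 'rV[R]_2) : W :=
  (Num.sqrt (\det (g p)))^-1 *:
    \sum_(j < 2) \sum_(k < 2)
      partial j (fun x => (Num.sqrt (\det (g x)) * invmx (g x) j k) *:
                          partial k F x) p.

(* As the Levi-Civita connection of Q is the tangential part of the flat
   connection, the tension field of F, seen as a map into Q, is the component of
   the Laplacian orthogonal to the unit normal F. *)
Definition tension (R : realType) (B : 'M[R]_6)
    (F : 'rV[R]_2 -> 'rV[R]_6) (p : 'rV[R]_2) : 'rV[R]_6 :=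
  let L := laplace_beltrami (induced_metric B F) F p in
  L - bilin B L (F p) *: F p.

Record minimal_surface (R : realType) (B : 'M[R]_6) (S : orientedSurface R)
    (phi : S -> 'rV[R]_6) : Prop := MinimalSurface {
  minimal_in_Q : forall x, quadric B (phi x);
  minimal_smooth : forall c, atlas c -> smooth_on (chart_im c) (local_rep phi c);
  minimal_immersion : forall c, atlas c -> forall p, chart_im c p ->
    \rank ('J (local_rep phi c) p) = 2%N;
  minimal_spacelike : forall c, atlas c -> forall p, chart_im c p ->
    forall v : 'rV[R]_6, (v <= 'J (local_rep phi c) p)%MS -> v != 0 ->
      0 < bilin B v v;
  minimal_harmonic : forall c, atlas c -> forall p, chart_im c p ->
    tension B (local_rep phi c) p = 0
}.

(* Local holomorphic coordinates for the conformal structure induced by phi: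
   oriented coordinates in which the induced metric is a positive multiple of
   dx^2 + dy^2. *)
Definition holomorphic_coordinate (R : realType) (B : 'M[R]_6)
    (S : orientedSurface R) (phi : S -> 'rV[R]_6) (c : chart R S) : Prop :=
  atlas c /\
  (forall p, chart_im c p ->
     exists2 l : R, 0 < l & induced_metric B (local_rep phi c) p = l%:M).

(* The recursion is meaningful as long as the h_i are non-vanishing; the inverse
   of 0 is 0 otherwise. *)
Fixpoint harmonic_seq (R : realType) (B : 'M[R]_6)
    (F : 'rV[R]_2 -> 'rV[R[i]]_6) (i : nat) : 'rV[R]_2 -> 'rV[R[i]]_6 :=
  match i with
  | 0 => F
  | j.+1 =>
      let G := harmonic_seq B F j in
      if j == 0%N then dz_vec G
      else fun p => dz_vec G p -
        (bilinC B (dz_vec G p) (conjv (G p)) / bilinC B (G p) (conjv (G p))) *: G p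
  end.

Definition phi_seq (R : realType) (B : 'M[R]_6) (S : orientedSurface R)
    (phi : S -> 'rV[R]_6) (c : chart R S) (i : nat) : 'rV[R]_2 -> 'rV[R[i]]_6 :=
  harmonic_seq B (fun p => toCmx (local_rep phi c p)) i.

Definition h_seq (R : realType) (B : 'M[R]_6) (S : orientedSurface R)
    (phi : S -> 'rV[R]_6) (c : chart R S) (i : nat) : 'rV[R]_2 -> R[i] :=
  fun p => bilinC B (phi_seq B phi c i p) (conjv (phi_seq B phi c i p)).

Definition isotropy_order2 (R : realType) (B : 'M[R]_6) (S : orientedSurface R)
    (phi : S -> 'rV[R]_6) : Prop :=
  forall c, holomorphic_coordinate B phi c -> forall p, chart_im c p ->
    [/\ h_seq B phi c 1 p != 0,
        h_seq B phi c 2 p != 0,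
        bilinC B (phi_seq B phi c 1 p) (phi_seq B phi c 1 p) = 0 &
        bilinC B (phi_seq B phi c 2 p) (phi_seq B phi c 2 p) = 0].

(* q (dz)^3 is given by its coefficient [q c] in every local holomorphic
   coordinate c; if w is another one, then q_z = q_w (w_z)^3. *)
Definition holomorphic_cubic_differential (R : realType) (B : 'M[R]_6)
    (S : orientedSurface R) (phi : S -> 'rV[R]_6)
    (q : chart R S -> 'rV[R]_2 -> R[i]) : Prop :=
  (forall c, holomorphic_coordinate B phi c -> holomorphic_on (chart_im c) (q c)) /\
  (forall c c', holomorphic_coordinate B phi c -> holomorphic_coordinate B phi c' ->
     forall p, overlap c c' p ->
       q c p = q c' (transition c c' p) *
               dz (fun x => toC (transition c c' x)) p ^+ 3).

(* Main.v *)
(* In a local holomorphic coordinate the vectors phi, phi_1, phi_2 and the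
   conjugates of the last two are orthogonal for the hermitian form, phi_3 is
   orthogonal to all of them, and differentiating these relations gives
     (phi_1)_zbar = - h_1 phi,          (log h_1)_(z zbar) = h_2 / h_1 - h_1,
     (phi_2)_zbar = - (h_2 / h_1) phi_1, (log h_2)_(z zbar) = h_3 / h_2 - h_2 / h_1,
     (phi_3)_zbar = - (h_3 / h_2) phi_2.
   The form is positive on the span of phi, phi_1 and its conjugate, so signature
   (3, 3) forces h_2 < 0.  With D = det (phi, phi_1, conj phi_1, phi_2, conj phi_2,
   phi_3) put q = sqrt (- det B) D / (h_1 h_2); Gram determinants give
   <phi_3, phi_3> = - q^2 and h_3 = - |q|^2, which turns the equations for log h_i
   into those of the theorem.  By the last formula above q^2 is holomorphic, hence
   so is q.  A change of coordinate with derivative l multiplies phi_i by l^i, thus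
   D by l^6 conj(l)^3 and h_1 h_2 by (l conj(l))^3, and q by l^3. *)

Require Import Defs.
From HB Require Import structures.
From mathcomp Require Import all_boot all_order all_algebra.
From mathcomp Require Import all_classical all_reals all_analysis.
From mathcomp Require Import perm complex.
From mathcomp Require Import ring lra.

Import Order.TTheory GRing.Theory Num.Theory.
Import numFieldNormedType.Exports.

Set Implicit Arguments.
Unset Strict Implicit.

Local Open Scope classical_set_scope.
Local Open Scope ring_scope.
Local Open Scope complex_scope.

(** What the sequence provides is [-<phi_3, phi_3>]. A square root of it needs a sign that agrees
    across coordinates and through zeros, and for a superminimal surface the zeros fill everything.
    The determinant makes this choice: phi, phi_1, phi_2 and the two conjugates span the
    complexification of a real 5-space on which the form is nondegenerate, and the volume form of
    R^6 orients its normal line. Conjugating phi_1 and phi_2 exchanges two pairs of rows and so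
    preserves the determinant; hence a single Gram identity, whose two frames may end in different
    vectors, yields q^2 (both end in phi_3) and |q|^2 (one ends in the conjugate of phi_3).

    Zeros matter again when holomorphy passes from q^2 to q. There is no division by q: where q_zbar
    is nonzero q must vanish, which is absurd on an open set.

    All differentiation takes place among smooth functions of two real variables. The one
    second-order fact is that d/dz and d/dzbar commute; it carries the harmonicity of phi up to
    phi_2 and phi_3. Complex differentiability appears only when q is shown to be holomorphic. *)

Lemma near_eq_differentiable (R : numFieldType) (V W : normedModType R)
    (f g : V -> W) (x : V) :
  (\near x, f x = g x) -> differentiable f x -> differentiable g x.
Proof.
move=> fg df.
have dc : continuous ('d f x : V -> W) by exact: diff_continuous.
have gE : g \o shift x = cst (g x) + 'd f x +o_ 0 id.
  have fg0 : \forall h \near 0, f (h + x) = g (h + x).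
    move: fg; rewrite (near_shift 0) subr0.
    by apply: filterS => h.
  have /diff_locally/eqaddoP fE := df.
  apply/eqaddoP => e e0; near=> h.
  rewrite !fctE /= -(nbhs_singleton fg).
  have <- : f (h + x) = g (h + x) by near: h.
  by near: h; exact: fE e e0.
have dE : 'd g x = 'd f x :> (V -> W) by exact: diff_unique.
by apply/diff_locallyP; split; rewrite dE.
Unshelve. all: by end_near. Qed.

(** * Functions of class C^k on an open set of the plane *)

Section Ck_theory.
Variable R : realType.
Local Notation E := 'rV[R]_2.
Implicit Types (V U : set E).

Section Ck_general.
Variable W : normedModType R.
Implicit Types f g : E -> W.

Lemma near_eq_on V f g p : open V -> V p -> (forall x, V x -> f x = g x) ->
  \forall x \near p, f x = g x.
Proof.
move=> oV Vp fg; have : nbhs p V by exact: open_nbhs_nbhs.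
by apply: filterS => x; exact: fg.
Qed.

Lemma partial_eq_on V k f g : open V -> (forall x, V x -> f x = g x) ->
  forall p, V p -> partial k f p = partial k g p.
Proof. by move=> oV fg p Vp; exact/near_eq_derive/near_eq_on/fg. Qed.

(** Formulas such as the product rule are available on [V] only, where differentiability is known.
    This lemma lets them be substituted for a partial derivative inside the inductions on the
    order. *)
Lemma Ck_eq_on k V f g : open V -> (forall x, V x -> f x = g x) ->
  Ck k V f -> Ck k V g.
Proof.
move=> oV; elim: k f g => [|k IH] f g fg /= => [cf p Vp|[df pf]].
  suff : g @ p --> g p by [].
  rewrite -(fg p Vp); apply: cvg_trans (cf p Vp).
  exact: near_eq_cvg (near_eq_on oV Vp fg).
split=> [p Vp|j]; last exact: IH (partial_eq_on j oV fg) (pf j).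
by apply: near_eq_differentiable (df p Vp); exact: near_eq_on oV Vp fg.
Qed.

Lemma CkW k V f : Ck k.+1 V f -> Ck k V f.
Proof.
elim: k f => [|k IH] f /= [df pf]; last by split=> // j; exact/IH/pf.
by move=> p Vp; exact/differentiable_continuous/df.
Qed.

Lemma Ck_sub k V U f : U `<=` V -> Ck k V f -> Ck k U f.
Proof.
move=> UV; elim: k f => [|k IH] f /= => [cf p /UV|[df pf]]; first exact: cf.
by split=> [p /UV|j]; [exact: df|exact/IH/pf].
Qed.

Lemma Ck_cst k V (a : W) : open V -> Ck k V (fun=> a).
Proof.
move=> oV; elim: k a => [|k IH] a /=; first by move=> p _; exact: cst_continuous.
split=> [p _|j]; first exact: differentiable_cst.
by apply: Ck_eq_on oV _ (IH 0) => p _; rewrite /partial derive_cst.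
Qed.

Lemma CkD k V f g : open V -> Ck k V f -> Ck k V g -> Ck k V (fun x => f x + g x).
Proof.
move=> oV; elim: k f g => [|k IH] f g /=.
  by move=> cf cg p Vp; exact: continuousD (cf p Vp) (cg p Vp).
move=> [df pf] [dg pg]; split=> [p Vp|j].
  exact: differentiableD (df p Vp) (dg p Vp).
apply: Ck_eq_on oV _ (IH _ _ (pf j) (pg j)) => p Vp; symmetry.
exact: deriveD (diff_derivable (df p Vp)) (diff_derivable (dg p Vp)).
Qed.

End Ck_general.

Lemma CkM k V (f g : E -> R) : open V -> Ck k V (f : E -> R^o) ->
  Ck k V (g : E -> R^o) -> Ck k V ((fun x => f x * g x) : E -> R^o).
Proof.
move=> oV; elim: k f g => [|k IH] f g.
  by move=> cf cg p Vp; exact: continuousM (cf p Vp) (cg p Vp).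
move=> Cf Cg; have [/= df pf] := Cf; have [/= dg pg] := Cg; split=> [p Vp|j].
  exact: differentiableM (df p Vp) (dg p Vp).
apply: Ck_eq_on oV _ (CkD oV (IH _ _ (CkW Cf) (pg j)) (IH _ _ (CkW Cg) (pf j))).
move=> p Vp; symmetry; rewrite /partial.
have Dm := @deriveM R _ f g p (delta_mx 0 j) (diff_derivable (df p Vp))
  (diff_derivable (dg p Vp)).
exact: Dm.
Qed.

Lemma differentiable_comp1 (f : E -> R) (u : R -> R) (d : R) p :
  differentiable (f : E -> R^o) p -> is_derive (f p) 1 u d ->
  differentiable (u \o f : E -> R^o) p.
Proof.
move=> df [/derivable1_diffP du _].
exact: (@differentiable_comp _ _ _ _ (f : E -> R^o) (u : R^o -> R^o) p df du).
Qed.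

Lemma partial_comp1 k (f : E -> R) (u : R -> R) (d : R) p :
  differentiable (f : E -> R^o) p -> is_derive (f p) 1 u d ->
  partial k (u \o f : E -> R^o) p = d * partial k (f : E -> R^o) p.
Proof.
move=> df ud; have [/derivable1_diffP du dE] := ud.
have chain := @diff_comp _ _ _ _ (f : E -> R^o) (u : R^o -> R^o) p df du.
have linu (t : R^o) : 'd (u : R^o -> R^o) (f p) t = d * t.
  by rewrite -dE (deriveE _ du) -[t in LHS]mulr1 [LHS]linearZ /= mulrC.
rewrite /partial (deriveE _ (differentiable_comp1 df ud)) chain /= linu.
by rewrite -(deriveE _ df).
Qed.

(* In the uses below [u'] is an elementary function of [u] or of the identity,
   which is why smoothness of [u \o f] of lower order is available for [u' \o f]:
   the induction on the order then closes up. *)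
Lemma Ck_comp1 k V (f : E -> R) (u u' : R -> R) : open V ->
  Ck k V (f : E -> R^o) ->
  (forall p, V p -> is_derive (f p) 1 u (u' (f p))) ->
  (forall j, (j < k)%N -> Ck j V (u \o f : E -> R^o) ->
     Ck j V (u' \o f : E -> R^o)) ->
  Ck k V (u \o f : E -> R^o).
Proof.
move=> oV; elim: k => [|k IH] Cf ud uC.
  move=> p Vp; apply: continuous_comp; first exact: Cf.
  apply: differentiable_continuous; apply/derivable1_diffP.
  by have := ud p Vp; case.
have [/= df pf] := Cf.
have Ck_u : Ck k V (u \o f : E -> R^o).
  by apply: IH ud _; [exact: CkW Cf|move=> j jk; apply: uC; exact: ltnW].
split=> [p Vp|j]; first exact: differentiable_comp1 (df p Vp) (ud p Vp).
have Cu' := uC k (ltnSn k) Ck_u.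
apply: Ck_eq_on oV _ (CkM oV Cu' (pf j)) => p Vp.
by rewrite (partial_comp1 j (df p Vp) (ud p Vp)).
Qed.

End Ck_theory.

Section smooth_theory.
Variable R : realType.
Local Notation E := 'rV[R]_2.
Implicit Types (V U : set E).

Lemma CkV k V (f : E -> R) : open V -> (forall p, V p -> f p != 0) ->
  Ck k V (f : E -> R^o) -> Ck k V ((fun x => (f x)^-1) : E -> R^o).
Proof.
move=> oV f0 Cf.
apply: (@Ck_comp1 R k V f (fun x => x^-1) (fun x => - (x^-1 * x^-1)) oV Cf).
  move=> p Vp.
  have d1 := @derivable_id R R^o (f p) 1.
  apply: DeriveDef; first exact: (@derivableV R R^o id (f p) 1 (f0 p Vp) d1).
  rewrite (@deriveV R R^o id (f p) 1 (f0 p Vp) d1) derive_id.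
  by rewrite /GRing.scale /= mulr1 expr2 invfM.
move=> j _ Cj.
have CN : Ck j V ((fun=> -1) : E -> R^o) by exact: Ck_cst.
apply: Ck_eq_on oV _ (CkM oV CN (CkM oV Cj Cj)) => p _ /=.
by rewrite mulN1r.
Qed.

Lemma Ck_ln k V (f : E -> R) : open V -> (forall p, V p -> 0 < f p) ->
  Ck k V (f : E -> R^o) -> Ck k V ((fun x => ln (f x)) : E -> R^o).
Proof.
move=> oV f0 Cf.
apply: (@Ck_comp1 R k V f (@ln R) (fun x => x^-1) oV Cf).
  by move=> p Vp; exact: is_derive1_ln (f0 p Vp).
move=> j jk _; apply: CkV => // [p /f0 /lt0r_neq0 //|].
(* What remains is to lower the order of regularity of [f] from [k] to [j], one derivative at a
   time. *)
elim: k jk Cf => // k IH; rewrite ltnS leq_eqVlt => /orP[/eqP->|jk] Cf.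
  exact: CkW.
by apply: IH jk _; exact: CkW.
Qed.

Lemma Ck_coord k V n (F : E -> 'rV[R]_n) (i : 'I_n) : open V -> Ck k V F ->
  Ck k V ((fun x => F x 0 i) : E -> R^o).
Proof.
move=> oV; elim: k F => [|k IH] F /=.
  move=> cF p Vp; apply: (@continuous_comp _ _ _ F (fun x : 'rV_n => x 0 i : R^o)).
    exact: cF.
  exact: coord_continuous.
move=> [dF pF]; split=> [p Vp|j].
  apply: (@differentiable_comp _ _ _ _ F (fun x : 'rV_n => x 0 i : R^o)).
    exact: dF.
  exact: differentiable_coord.
apply: Ck_eq_on oV _ (IH _ (pF j)) => p Vp; rewrite /partial.
by rewrite (derive_mx (diff_derivable (dF p Vp))) mxE.
Qed.

End smooth_theory.

(** * Symmetry of mixed second derivatives *)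

Section mixed_derivatives.
Variables (R : realType) (T : normedModType R).

Lemma MVT_closed (g dg : R -> R) (h : R) : 0 < h ->
  (forall t : R, 0 <= t <= h -> is_derive t (1 : R^o) (g : R^o -> R^o) (dg t)) ->
  exists2 t, 0 <= t <= h & g h - g 0 = dg t * h.
Proof.
move=> h0 gd.
have [| |t] := @MVT R g dg 0 h h0.
- by move=> t; rewrite in_itv /= => /andP[t0 th]; apply: gd; rewrite !ltW.
- by apply: derivable_within_continuous => t; rewrite in_itv /= => /gd [].
by rewrite in_itv subr0 /= => /andP[t0 th] E; exists t; rewrite // !ltW.
Qed.

(** The alternating sum over the corners of a parallelogram. Its symmetry in [u] and [v] is what
    forces the two mixed derivatives to agree. *)
Let second_difference (f : T -> R^o) (u v p : T) (h : R) :=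
  f (p + h *: u + h *: v) - f (p + h *: u) - f (p + h *: v) + f p.

Lemma is_derive_line (f : T -> R^o) (a u : T) (t : R) :
  differentiable f (a + t *: u) ->
  is_derive t (1 : R^o) ((fun s => f (a + s *: u)) : R^o -> R^o)
    ('D_u f (a + t *: u)).
Proof.
move=> df.
have dl : is_diff t ((fun s : R^o => a + s *: u) : R^o -> T) ((fun s => s *: u) : R^o -> T).
  have := @is_diffD _ _ _ (cst a) (fun s : R^o => s *: u) (cst 0) (fun s : R^o => s *: u) t
    (is_diff_cst a t) (is_diff_scalel t u).
  by move=> /(@is_diff_eq) ; apply; apply/funext => s; rewrite fctE /= add0r.
have dc : is_diff t ((fun s => f (a + s *: u)) : R^o -> R^o) ('d f (a + t *: u) \o (fun s : R^o => s *: u)).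
  exact: (@is_diff_comp _ _ _ _ (fun s : R^o => a + s *: u) (fun s : R^o => s *: u) f
    ('d f (a + t *: u)) t dl (differentiableP df)).
apply: DeriveDef; first by apply/derivable1_diffP; case: dc.
by rewrite deriveE; [rewrite diff_val /= scale1r -deriveE|case: dc].
Qed.

(** The mean value theorem is applied twice: along [u] to the increment of [f] in the direction
    [h *: v], then along [v] to the derivative ['D_u f] that results. *)
Lemma second_differenceE (f : T -> R^o) (u v p : T) (h : R) : 0 < h ->
  (forall s t, 0 <= s <= h -> 0 <= t <= h ->
     differentiable f (p + s *: u + t *: v) /\
     differentiable ('D_u f : T -> R^o) (p + s *: u + t *: v)) ->
  exists s t, [/\ 0 <= s <= h, 0 <= t <= h &
    second_difference f u v p h = h ^+ 2 * 'D_v ('D_u f) (p + s *: u + t *: v)].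
Proof.
move=> h0 df.
have hh : 0 <= h <= h by rewrite lexx ltW.
have h00 : 0 <= (0 : R) <= h by rewrite lexx ltW.
pose g s := f (p + s *: u + h *: v) - f (p + s *: u).
have dg (s : R) : 0 <= s <= h -> is_derive s (1 : R^o) (g : R^o -> R^o)
    ('D_u f (p + s *: u + h *: v) - 'D_u f (p + s *: u)).
  move=> sh; apply: is_deriveB.
    have [d1 _] := df s h sh hh; rewrite addrAC in d1.
    have := is_derive_line d1; rewrite addrAC.
    by under eq_fun do rewrite addrAC.
  have [d1 _] := df s 0 sh h00; rewrite scale0r addr0 in d1.
  exact: is_derive_line d1.
have [s sI gE] := MVT_closed h0 dg.
pose k t := 'D_u f (p + s *: u + t *: v).
have dk (t : R) : 0 <= t <= h -> is_derive t (1 : R^o) (k : R^o -> R^o)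
    ('D_v ('D_u f) (p + s *: u + t *: v)).
  by move=> th; apply: is_derive_line; have [_] := df s t sI th.
have [t tI kE] := MVT_closed h0 dk.
exists s, t; split=> //.
move: kE gE; rewrite /k /g !scale0r !addr0 => -> gE.
rewrite /second_difference expr2 mulrC mulrA -gE.
by rewrite opprD opprK addrA.
Qed.

Lemma second_differenceC (f : T -> R^o) (u v p : T) (h : R) :
  second_difference f u v p h = second_difference f v u p h.
Proof.
rewrite /second_difference (addrAC p (h *: u)).
by rewrite (addrAC (f (p + h *: v + h *: u)) (- f (p + h *: u))).
Qed.

(** Divided by [h ^+ 2], the same second difference is a value of either mixed derivative at some
    point of a small parallelogram. Continuity at [p] brings both values within [e / 2] of the
    values at [p]. *)
Lemma derive_schwarz (V : set T) (f : T -> R^o) (u v p : T) : open V -> V p ->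
  (forall x, V x -> differentiable f x) ->
  (forall x, V x -> differentiable ('D_u f : T -> R^o) x) ->
  (forall x, V x -> differentiable ('D_v f : T -> R^o) x) ->
  {for p, continuous ('D_v ('D_u f) : T -> R^o)} ->
  {for p, continuous ('D_u ('D_v f) : T -> R^o)} ->
  'D_v ('D_u f) p = 'D_u ('D_v f) p.
Proof.
move=> oV Vp df duf dvf cvu cuv; apply/eqP; rewrite -subr_eq0 -normr_le0.
apply/ler_addgt0Pr => e e0; rewrite add0r.
have e20 : 0 < e / 2 by rewrite divr_gt0.
have /nbhs_ballP[r /= r0 rP] : \forall x \near p, [/\ V x,
    `|'D_v ('D_u f) p - 'D_v ('D_u f) x| < e / 2 &
    `|'D_u ('D_v f) p - 'D_u ('D_v f) x| < e / 2].
  have nV : \forall x \near p, V x by exact: open_nbhs_nbhs.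
  have nvu : \forall x \near p, `|'D_v ('D_u f) p - 'D_v ('D_u f) x| < e / 2.
    exact: ((@cvgrPdist_lt _ _ _ _ _ _ _).1 cvu _ e20).
  have nuv : \forall x \near p, `|'D_u ('D_v f) p - 'D_u ('D_v f) x| < e / 2.
    exact: ((@cvgrPdist_lt _ _ _ _ _ _ _).1 cuv _ e20).
  apply: filterS (filterI nV (filterI nvu nuv)) => x [Vx [xvu xuv]].
  by split.
(* With this [h], every point of the parallelogram lies within [h * M = r / 2] of [p]; the summand 1
   keeps [M] positive when [u = v = 0]. *)
pose M := `|u| + `|v| + 1.
have M0 : 0 < M by rewrite ltr_wpDl // addr_ge0.
pose h := r / 2 / M.
have h0 : 0 < h by rewrite !divr_gt0.
have inball (s t : R) : 0 <= s <= h -> 0 <= t <= h -> ball p r (p + s *: u + t *: v).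
  move=> /andP[s0 sh] /andP[t0 th]; rewrite -ball_normE /=.
  rewrite -addrA opprD addNKr normrN.
  have : `|s *: u + t *: v| <= h * M.
    apply: (le_trans (ler_normD _ _)); rewrite !normrZ !ger0_norm // /M !mulrDr.
    by rewrite ler_wpDr ?mulr1 ?(ltW h0) // lerD // ler_wpM2r.
  move/le_lt_trans; apply.
  by rewrite /h divfK ?gt_eqF // ltr_pdivrMr // ltr_pMr // ltr1n.
have [|s [t [sI tI E1]]] := @second_differenceE f u v p h h0.
  by move=> s t sI tI; have [Vx _ _] := rP _ (inball s t sI tI); split; auto.
have [|t' [s' [tI' sI' E2]]] := @second_differenceE f v u p h h0.
  move=> s' t' sI' tI'; have [Vx _ _] : [/\ V (p + s' *: v + t' *: u), True & True].
    by split=> //; rewrite addrAC; have [] := rP _ (inball t' s' tI' sI').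
  by split; auto.
have [_ B1 _] := rP _ (inball s t sI tI).
have [_ _ B2] := rP _ (inball s' t' sI' tI').
rewrite addrAC in B2.
move: E2; rewrite second_differenceC E1 => /(mulfI (expf_neq0 2 (lt0r_neq0 h0))) E2.
rewrite -E2 in B2.
move: B1 B2; move: ('D_v ('D_u f) _) ('D_v ('D_u f) p) ('D_u ('D_v f) p) => x a b.
move=> ax bx; apply: (le_trans (ler_distD x a b)).
by rewrite [leRHS]splitr (distrC x b); apply: lerD; exact: ltW.
Qed.

End mixed_derivatives.

(** * Wirtinger derivatives *)

Section complex_calculus.
Variable R : realType.
Local Notation E := 'rV[R]_2.
Implicit Types (V U : set E).

Definition smoothC V (f : E -> R[i]) : Prop :=
  smooth_on V ((fun x => complex.Re (f x)) : E -> R^o) /\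
  smooth_on V ((fun x => complex.Im (f x)) : E -> R^o).

Lemma partialD k (f g : E -> R^o) p : differentiable f p -> differentiable g p ->
  partial k (fun x => f x + g x) p = partial k f p + partial k g p.
Proof.
by move=> df dg; exact: deriveD (diff_derivable df) (diff_derivable dg).
Qed.

Lemma partialN k (f : E -> R^o) p : differentiable f p ->
  partial k (fun x => - f x) p = - partial k f p.
Proof. by move=> df; exact: deriveN (diff_derivable df). Qed.

Lemma partialM k (f g : E -> R^o) p : differentiable f p -> differentiable g p ->
  partial k ((fun x => f x * g x) : E -> R^o) p =
  f p * partial k g p + g p * partial k f p.
Proof.
move=> df dg.
exact: (@deriveM R _ f g p (delta_mx 0 k) (diff_derivable df) (diff_derivable dg)).
Qed.

Lemma smooth_diff V (f : E -> R^o) p : smooth_on V f -> V p -> differentiable f p.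
Proof. by move=> /(_ 1%N) [df _]; exact: df. Qed.

Lemma smooth_onN V (f : E -> R^o) : open V -> smooth_on V f ->
  smooth_on V ((fun x => - f x) : E -> R^o).
Proof.
move=> oV sf k.
have CN : Ck k V ((fun=> -1) : E -> R^o) by exact: Ck_cst.
apply: Ck_eq_on oV _ (CkM oV CN (sf k)) => p _ /=.
by rewrite mulN1r.
Qed.

Lemma smoothC_eq_on V (f g : E -> R[i]) : open V -> (forall x, V x -> f x = g x) ->
  smoothC V f -> smoothC V g.
Proof.
move=> oV fg [sr si]; split=> k.
  by apply: Ck_eq_on oV _ (sr k) => x Vx; rewrite fg.
by apply: Ck_eq_on oV _ (si k) => x Vx; rewrite fg.
Qed.

Lemma smoothC_sub V U f : U `<=` V -> smoothC V f -> smoothC U f.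
Proof.
by move=> UV [sr si]; split=> k; [exact: Ck_sub UV (sr k)|exact: Ck_sub UV (si k)].
Qed.

Lemma smoothC_cst V (a : R[i]) : open V -> smoothC V (fun=> a).
Proof. by move=> oV; split=> k; exact: Ck_cst. Qed.

Lemma smoothC_real V (f : E -> R) : open V -> smooth_on V (f : E -> R^o) ->
  smoothC V (fun x => (f x)%:C).
Proof. by move=> oV sf; split=> // k; exact: Ck_cst. Qed.

Lemma smoothCD V f g : open V -> smoothC V f -> smoothC V g ->
  smoothC V (fun x => f x + g x).
Proof.
move=> oV [fr fi] [gr gi]; split=> k.
  apply: Ck_eq_on oV _ (CkD oV (fr k) (gr k)) => x _.
  by case: (f x) (g x) => [? ?] [? ?].
apply: Ck_eq_on oV _ (CkD oV (fi k) (gi k)) => x _.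
by case: (f x) (g x) => [? ?] [? ?].
Qed.

Lemma smoothCM V f g : open V -> smoothC V f -> smoothC V g ->
  smoothC V (fun x => f x * g x).
Proof.
move=> oV [fr fi] [gr gi]; split=> k.
  apply: Ck_eq_on oV _ (CkD oV (CkM oV (fr k) (gr k))
    (smooth_onN oV (fun k => CkM oV (fi k) (gi k)) k)) => x _.
  by case: (f x) (g x) => [? ?] [? ?].
apply: Ck_eq_on oV _ (CkD oV (CkM oV (fr k) (gi k)) (CkM oV (fi k) (gr k))) => x _.
by case: (f x) (g x) => [? ?] [? ?].
Qed.

Lemma smoothCN V f : open V -> smoothC V f -> smoothC V (fun x => - f x).
Proof.
move=> oV sf; apply: smoothC_eq_on oV _ (smoothCM oV (smoothC_cst (-1) oV) sf).
by move=> x _; rewrite mulN1r.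
Qed.

Lemma smoothCB V f g : open V -> smoothC V f -> smoothC V g ->
  smoothC V (fun x => f x - g x).
Proof. by move=> oV sf sg; apply: smoothCD => //; exact: smoothCN. Qed.

(* In ring scope [^*] is [Num.conj]; [conjc] is spelled out to have a single form
   of the conjugate. *)
Lemma smoothC_conj V f : open V -> smoothC V f -> smoothC V (fun x => conjc (f x)).
Proof.
move=> oV [fr fi]; split=> k.
  by apply: Ck_eq_on oV _ (fr k) => x _; case: (f x).
by apply: Ck_eq_on oV _ (smooth_onN oV fi k) => x _; case: (f x).
Qed.

Lemma smoothCV V f : open V -> (forall p, V p -> f p != 0) -> smoothC V f ->
  smoothC V (fun x => (f x)^-1).
Proof.
move=> oV f0 sf; have [fr fi] := sf.
(* [n] is the squared modulus, so the inverse of [f] is its conjugate times the real function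
   [1 / n]. *)
pose n x := complex.Re (f x) * complex.Re (f x) + complex.Im (f x) * complex.Im (f x).
have n0 x : V x -> n x != 0.
  move/f0; rewrite /n; case: (f x) => a b; apply: contraNN => /=.
  by rewrite -!expr2 paddr_eq0 ?sqr_ge0 // !sqrf_eq0 eq_complex.
have sn : smooth_on V ((fun x => (n x)^-1) : E -> R^o).
  by move=> k; apply: CkV => //; apply: CkD => //; exact: CkM.
apply: smoothC_eq_on oV _ (smoothCM oV (smoothC_conj oV sf) (smoothC_real oV sn)).
move=> x Vx; rewrite /n; case: (f x) => a b.
apply/eqP; rewrite eq_complex /= !mulr0 subr0 add0r -!expr2 mulNr.
by rewrite eqxx /=.
Qed.

Lemma smoothC_sum V (I : finType) (f : I -> E -> R[i]) : open V ->
  (forall i, smoothC V (f i)) -> smoothC V (fun x => \sum_i f i x).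
Proof.
move=> oV sf.
suff H (s : seq I) : smoothC V (fun x => \sum_(i <- s) f i x) by exact: H.
elim: s => [|i s IH].
  by apply: smoothC_eq_on oV _ (smoothC_cst 0 oV) => x _; rewrite big_nil.
by apply: smoothC_eq_on oV _ (smoothCD oV (sf i) IH) => x _; rewrite big_cons.
Qed.

Lemma smoothC_prod V (I : finType) (f : I -> E -> R[i]) : open V ->
  (forall i, smoothC V (f i)) -> smoothC V (fun x => \prod_i f i x).
Proof.
move=> oV sf.
suff H (s : seq I) : smoothC V (fun x => \prod_(i <- s) f i x) by exact: H.
elim: s => [|i s IH].
  by apply: smoothC_eq_on oV _ (smoothC_cst 1 oV) => x _; rewrite big_nil.
by apply: smoothC_eq_on oV _ (smoothCM oV (sf i) IH) => x _; rewrite big_cons.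
Qed.

Lemma smoothC_det V n (M : E -> 'M[R[i]]_n) : open V ->
  (forall i j, smoothC V (fun x => M x i j)) -> smoothC V (fun x => \det (M x)).
Proof.
move=> oV sM; apply: smoothC_sum => // s; apply: smoothCM => //.
  exact: smoothC_cst.
by apply: smoothC_prod.
Qed.

Lemma smoothC_partialC V k f : smoothC V f -> smoothC V (partialC k f).
Proof. move=> [fr fi]; split=> j; first by have [_ /(_ k)] := fr j.+1.
by have [_ /(_ k)] := fi j.+1. Qed.

Lemma partialC_eq_on V k f g : open V -> (forall x, V x -> f x = g x) ->
  forall p, V p -> partialC k f p = partialC k g p.
Proof.
move=> oV fg p Vp; rewrite /partialC; congr Complex;
  by apply: partial_eq_on oV _ _ Vp => x /fg ->.
Qed.

Lemma partialC_cst k (a : R[i]) p : partialC k (fun=> a) p = 0.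
Proof. by apply/eqP; rewrite eq_complex /= /partial !derive_cst eqxx. Qed.

Lemma partialCD V k f g p : smoothC V f -> smoothC V g -> V p ->
  partialC k (fun x => f x + g x) p = partialC k f p + partialC k g p.
Proof.
move=> [fr fi] [gr gi] Vp.
apply/eqP; rewrite eq_complex /= -!partialD; do ?exact: smooth_diff Vp.
apply/andP; split; apply/eqP; congr (partial k _ p); apply/funext => x;
  by case: (f x) (g x) => [? ?] [? ?].
Qed.

Lemma partialCM V k f g p : open V -> smoothC V f -> smoothC V g -> V p ->
  partialC k (fun x => f x * g x) p = partialC k f p * g p + f p * partialC k g p.
Proof.
move=> oV [fr fi] [gr gi] Vp.
have [dfr dfi dgr dgi] : [/\ differentiable ((fun x => complex.Re (f x)) : E -> R^o) p,
  differentiable ((fun x => complex.Im (f x)) : E -> R^o) p,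
  differentiable ((fun x => complex.Re (g x)) : E -> R^o) p &
  differentiable ((fun x => complex.Im (g x)) : E -> R^o) p].
  by split; exact: smooth_diff Vp.
rewrite /partialC.
have -> : (fun x => complex.Re (f x * g x)) =
    (fun x => complex.Re (f x) * complex.Re (g x) + - (complex.Im (f x) * complex.Im (g x))).
  by apply/funext => x; case: (f x) (g x) => [? ?] [? ?].
have -> : (fun x => complex.Im (f x * g x)) =
    (fun x => complex.Re (f x) * complex.Im (g x) + complex.Im (f x) * complex.Re (g x)).
  by apply/funext => x; case: (f x) (g x) => [? ?] [? ?].
have dM (u v : E -> R^o) : differentiable u p -> differentiable v p ->
    differentiable ((fun x => u x * v x) : E -> R^o) p.
  by move=> du dv; exact: differentiableM.
rewrite (partialD k (dM _ _ dfr dgr) (differentiableN (dM _ _ dfi dgi))).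
rewrite (partialD k (dM _ _ dfr dgi) (dM _ _ dfi dgr)).
rewrite (partialN k (dM _ _ dfi dgi)) !partialM //.
move: (partial _ _ _) (partial _ _ _) (partial _ _ _) (partial _ _ _) => a b c d.
case: (f p) (g p) => [u v] [w z] /=; apply/eqP; rewrite eq_complex /=.
by apply/andP; split; apply/eqP; ring.
Qed.

Lemma partialC_conj V k f p : smoothC V f -> V p ->
  partialC k (fun x => conjc (f x)) p = conjc (partialC k f p).
Proof.
move=> [fr fi] Vp; rewrite /partialC /=.
rewrite -partialN; last exact: smooth_diff Vp.
by congr Complex; congr (partial k _ p); apply/funext => x; case: (f x).
Qed.

Lemma partial_schwarz V i j (u : E -> R^o) p : open V -> smooth_on V u -> V p ->
  partial i (partial j u) p = partial j (partial i u) p.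
Proof.
move=> oV su Vp; apply: (derive_schwarz oV Vp).
- by move=> x; exact: smooth_diff.
- by move=> x; have [_ /(_ j) [+ _]] := su 2%N; apply.
- by move=> x; have [_ /(_ i) [+ _]] := su 2%N; apply.
- by have [_ /(_ j) [_ /(_ i) /=]] := su 2%N; apply.
- by have [_ /(_ i) [_ /(_ j) /=]] := su 2%N; apply.
Qed.

Lemma partialC_schwarz V i j f p : open V -> smoothC V f -> V p ->
  partialC i (partialC j f) p = partialC j (partialC i f) p.
Proof.
move=> oV [fr fi] Vp; rewrite /partialC /=.
exact: (f_equal2 (@Complex _) (partial_schwarz i j oV fr Vp) (partial_schwarz i j oV fi Vp)).
Qed.

(** Both Wirtinger derivatives at once: [s = - 'i] is d/dz and [s = 'i] is d/dzbar, so each rule is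
    proved once, and conjugation acts by conjugating [s]. *)
Definition dop (s : R[i]) (f : E -> R[i]) : E -> R[i] :=
  fun p => (partialC 0 f p + s * partialC 1 f p) / 2%:R.

Lemma dzE f : dz f = dop (- 'i) f.
Proof. by apply/funext => p; rewrite /dz /dop mulNr. Qed.

Lemma dzbarE f : dzbar f = dop 'i f.
Proof. by []. Qed.

Lemma smoothC_dop V s f : open V -> smoothC V f -> smoothC V (dop s f).
Proof.
move=> oV sf; apply: smoothCM => //; last exact: smoothC_cst.
apply: smoothCD => //; first exact: smoothC_partialC.
by apply: smoothCM => //; [exact: smoothC_cst|exact: smoothC_partialC].
Qed.

Lemma dop_eq_on V s f g : open V -> (forall x, V x -> f x = g x) ->
  forall p, V p -> dop s f p = dop s g p.
Proof.
by move=> oV fg p Vp; rewrite /dop !(partialC_eq_on _ oV fg).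
Qed.

Lemma dop_cst s a p : dop s (fun=> a) p = 0.
Proof. by rewrite /dop !partialC_cst mulr0 addr0 mul0r. Qed.

Lemma dopD V s f g p : smoothC V f -> smoothC V g -> V p ->
  dop s (fun x => f x + g x) p = dop s f p + dop s g p.
Proof. by move=> sf sg Vp; rewrite /dop !(partialCD _ sf sg Vp); ring. Qed.

Lemma dopM V s f g p : open V -> smoothC V f -> smoothC V g -> V p ->
  dop s (fun x => f x * g x) p = dop s f p * g p + f p * dop s g p.
Proof. by move=> oV sf sg Vp; rewrite /dop !(partialCM _ oV sf sg Vp); ring. Qed.

Lemma dopN V s f p : open V -> smoothC V f -> V p ->
  dop s (fun x => - f x) p = - dop s f p.
Proof.
move=> oV sf Vp.
rewrite -(@dop_eq_on V s (fun x => -1 * f x)) //; last by move=> x _; rewrite mulN1r.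
by rewrite (dopM _ oV (smoothC_cst _ oV) sf Vp) dop_cst mul0r add0r mulN1r.
Qed.

Lemma dopB V s f g p : open V -> smoothC V f -> smoothC V g -> V p ->
  dop s (fun x => f x - g x) p = dop s f p - dop s g p.
Proof.
move=> oV sf sg Vp.
by rewrite (dopD _ sf (smoothCN oV sg) Vp) (dopN _ oV sg Vp).
Qed.

(** The product rule for [(f / g) * g], solved for the derivative of the quotient. *)
Lemma dop_div V s f g p : open V -> smoothC V f -> smoothC V g ->
  (forall x, V x -> g x != 0) -> V p ->
  dop s (fun x => f x / g x) p = (dop s f p - f p / g p * dop s g p) / g p.
Proof.
move=> oV sf sg g0 Vp.
have sV := smoothCV oV g0 sg; have sq := smoothCM oV sf sV.
have -> : dop s f p = dop s (fun x => (f x / g x) * g x) p.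
  by apply: dop_eq_on oV _ _ Vp => x Vx; rewrite divfK ?g0.
by rewrite (dopM _ oV sq sg Vp) addrK mulfK ?g0.
Qed.

Lemma dop_sum V s (I : finType) (f : I -> E -> R[i]) p : open V ->
  (forall i, smoothC V (f i)) -> V p ->
  dop s (fun x => \sum_i f i x) p = \sum_i dop s (f i) p.
Proof.
move=> oV sf Vp.
suff H (l : seq I) : smoothC V (fun x => \sum_(i <- l) f i x) /\
  dop s (fun x => \sum_(i <- l) f i x) p = \sum_(i <- l) dop s (f i) p.
  by have [] := H (index_enum I).
elim: l => [|i l [IH1 IH2]].
  split; first by apply: smoothC_eq_on oV _ (smoothC_cst 0 oV) => x _; rewrite big_nil.
  rewrite big_nil -[RHS](dop_cst s 0 p).
  by apply: dop_eq_on oV _ _ Vp => x _; rewrite big_nil.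
have E1 x : V x -> f i x + \sum_(i <- l) f i x = \sum_(j <- i :: l) f j x.
  by move=> _; rewrite big_cons.
split; first by apply: smoothC_eq_on oV E1 (smoothCD oV (sf i) IH1).
by rewrite -(dop_eq_on s oV E1 Vp) (dopD _ (sf i) IH1 Vp) IH2 big_cons.
Qed.

Lemma dop_conj V s f p : smoothC V f -> V p ->
  dop s (fun x => conjc (f x)) p = conjc (dop (conjc s) f p).
Proof.
move=> sf Vp; rewrite /dop !(partialC_conj _ sf Vp).
by rewrite rmorphM rmorphD rmorphM fmorphV rmorph_nat /= conjcK.
Qed.

(** The operators are combinations of commuting partial derivatives with constant coefficients. This
    is the integrability condition behind the formulas for (phi_2)_zbar and (phi_3)_zbar. *)
Lemma dop_comm V s t f p : open V -> smoothC V f -> V p ->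
  dop s (dop t f) p = dop t (dop s f) p.
Proof.
move=> oV sf Vp.
have E1 (k : 'I_2) (u : R[i]) : partialC k (dop u f) p =
    (partialC k (partialC 0 f) p + u * partialC k (partialC 1 f) p) / 2%:R.
  have s0 := smoothC_partialC 0 sf; have s1 := smoothC_partialC 1 sf.
  have c c0 := smoothC_cst c0 oV.
  rewrite (partialCM _ oV (smoothCD oV s0 (smoothCM oV (c u) s1)) (c _) Vp).
  rewrite (partialCD _ s0 (smoothCM oV (c u) s1) Vp) (partialCM _ oV (c u) s1 Vp).
  by rewrite !partialC_cst mulr0 mul0r addr0 add0r.
rewrite [LHS]/dop [RHS]/dop (E1 0) (E1 1) (E1 0 s) (E1 1 s).
rewrite (partialC_schwarz 0 1 oV sf Vp).
move: (partialC 0 (partialC 0 f) p) (partialC 1 (partialC 0 f) p).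
by move: (partialC 1 (partialC 1 f) p) => a b c; ring.
Qed.

End complex_calculus.

(** * The complex bilinear extension of a real form *)

Lemma toCmx_tr (R : realType) m n (A : 'M[R]_(m, n)) :
  toCmx A^T = (toCmx A)^T.
Proof. by apply/matrixP => i j; rewrite !mxE. Qed.

Section bilinear_algebra.
Variables (R : realType) (n : nat) (B : 'M[R]_n).
Implicit Types x y z : 'rV[R[i]]_n.

Lemma bilinCDl x y z : bilinC B (x + y) z = bilinC B x z + bilinC B y z.
Proof. by rewrite /bilinC /bilin !mulmxDl mxE. Qed.

Lemma bilinCDr x y z : bilinC B x (y + z) = bilinC B x y + bilinC B x z.
Proof. by rewrite /bilinC /bilin linearD mulmxDr mxE. Qed.

Lemma bilinCZl a x y : bilinC B (a *: x) y = a * bilinC B x y.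
Proof. by rewrite /bilinC /bilin -!scalemxAl mxE. Qed.

Lemma bilinCZr a x y : bilinC B x (a *: y) = a * bilinC B x y.
Proof. by rewrite /bilinC /bilin linearZ -scalemxAr mxE. Qed.

Lemma bilinCBl x y z : bilinC B (x - y) z = bilinC B x z - bilinC B y z.
Proof. by rewrite bilinCDl -(scaleN1r y) bilinCZl mulN1r. Qed.

Lemma bilinC_sum x y :
  bilinC B x y = \sum_i \sum_j x 0 i * (B i j)%:C * y 0 j.
Proof.
rewrite /bilinC /bilin mxE exchange_big /=; apply: eq_bigr => j _.
by rewrite !mxE mulr_suml; apply: eq_bigr => i _; rewrite !mxE.
Qed.

Lemma bilinC_sym x y : B^T = B -> bilinC B x y = bilinC B y x.
Proof.
move=> Bs; rewrite /bilinC /bilin -[LHS]/(_ 0 0).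
rewrite -[in LHS](trmxK (x *m _ *m _)) mxE !trmx_mul trmxK mulmxA.
by rewrite -toCmx_tr Bs.
Qed.

Lemma bilinC_conj x y : conjc (bilinC B x y) = bilinC B (conjv x) (conjv y).
Proof.
rewrite !bilinC_sum rmorph_sum; apply: eq_bigr => i _.
rewrite rmorph_sum; apply: eq_bigr => j _.
by rewrite !rmorphM /= !mxE oppr0.
Qed.

Lemma bilinC_real (x y : 'rV[R]_n) : bilinC B (toCmx x) (toCmx y) = (bilin B x y)%:C.
Proof. by rewrite /bilinC /bilin -toCmx_tr /toCmx -!map_mxM mxE. Qed.

Lemma conjvK x : conjv (conjv x) = x.
Proof. by apply/rowP => k; rewrite !mxE conjcK. Qed.

Lemma conjvD x y : conjv (x + y) = conjv x + conjv y.
Proof. by apply/rowP => k; rewrite !mxE rmorphD. Qed.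

Lemma conjvZ a x : conjv (a *: x) = conjc a *: conjv x.
Proof. by apply/rowP => k; rewrite !mxE rmorphM. Qed.

Lemma conjv_real (x : 'rV[R]_n) : conjv (toCmx x) = toCmx x.
Proof. by apply/rowP => k; rewrite !mxE conjc_real. Qed.

End bilinear_algebra.

(** * Differentiation of vector fields and of their products *)

Section vector_fields.
Variables (R : realType) (n : nat) (B : 'M[R]_n).
Local Notation E := 'rV[R]_2.
Variable V : set E.
Hypothesis oV : open V.
Implicit Types F G : E -> 'rV[R[i]]_n.

Definition smoothv F : Prop := forall k, smoothC V (fun x => F x 0 k).

Definition dopv (s : R[i]) F : E -> 'rV[R[i]]_n :=
  fun p => \row_k dop s (fun x => F x 0 k) p.

Lemma dz_vecE F : dz_vec F = dopv (- 'i) F.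
Proof. by apply/funext => p; apply/rowP => k; rewrite !mxE dzE. Qed.

Lemma smoothv_eq_on F G : (forall x, V x -> F x = G x) -> smoothv F -> smoothv G.
Proof. by move=> FG sF k; apply: smoothC_eq_on oV _ (sF k) => x /FG ->. Qed.

Lemma smoothv_dop s F : smoothv F -> smoothv (dopv s F).
Proof.
move=> sF k; apply: smoothC_eq_on oV _ (smoothC_dop s oV (sF k)) => x _.
by rewrite mxE.
Qed.

Lemma smoothvZ f F : smoothC V f -> smoothv F -> smoothv (fun x => f x *: F x).
Proof.
move=> sf sF k; apply: smoothC_eq_on oV _ (smoothCM oV sf (sF k)) => x _.
by rewrite mxE.
Qed.

Lemma smoothvB F G : smoothv F -> smoothv G -> smoothv (fun x => F x - G x).
Proof.
move=> sF sG k; apply: smoothC_eq_on oV _ (smoothCB oV (sF k) (sG k)) => x _.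
by rewrite !mxE.
Qed.

Lemma smoothv_conj F : smoothv F -> smoothv (fun x => conjv (F x)).
Proof.
move=> sF k; apply: smoothC_eq_on oV _ (smoothC_conj oV (sF k)) => x _.
by rewrite mxE.
Qed.

Lemma smoothC_bilin F G : smoothv F -> smoothv G ->
  smoothC V (fun x => bilinC B (F x) (G x)).
Proof.
move=> sF sG.
have sFG i j : smoothC V (fun x => F x 0 i * (B i j)%:C * G x 0 j).
  by apply: smoothCM (sG j) => //; apply: smoothCM (sF i) _ => //; exact: smoothC_cst.
apply: smoothC_eq_on oV _ (smoothC_sum oV (fun i => smoothC_sum oV (sFG i))) => x _.
by rewrite bilinC_sum.
Qed.

Lemma dopv_eq_on s F G : (forall x, V x -> F x = G x) ->
  forall p, V p -> dopv s F p = dopv s G p.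
Proof.
move=> FG p Vp; apply/rowP => k; rewrite !mxE.
by apply: dop_eq_on oV _ _ Vp => x /FG ->.
Qed.

Lemma dopvZ s f F p : smoothC V f -> smoothv F -> V p ->
  dopv s (fun x => f x *: F x) p = dop s f p *: F p + f p *: dopv s F p.
Proof.
move=> sf sF Vp; apply/rowP => k; rewrite !mxE -(dopM _ oV sf (sF k) Vp).
by apply: dop_eq_on oV _ _ Vp => x _; rewrite mxE.
Qed.

Lemma dopvB s F G p : smoothv F -> smoothv G -> V p ->
  dopv s (fun x => F x - G x) p = dopv s F p - dopv s G p.
Proof.
move=> sF sG Vp; apply/rowP => k; rewrite !mxE -(dopB _ oV (sF k) (sG k) Vp).
by apply: dop_eq_on oV _ _ Vp => x _; rewrite !mxE.
Qed.

Lemma dopv_lincomb s a b F G p : smoothv F -> smoothv G -> V p ->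
  dopv s (fun x => a *: F x - b *: G x) p = a *: dopv s F p - b *: dopv s G p.
Proof.
move=> sF sG Vp.
have sa := smoothvZ (smoothC_cst a oV) sF; have sb := smoothvZ (smoothC_cst b oV) sG.
rewrite (dopvB s sa sb Vp) (dopvZ s (smoothC_cst a oV) sF Vp).
by rewrite (dopvZ s (smoothC_cst b oV) sG Vp) !dop_cst !scale0r !add0r.
Qed.

Lemma dopv_comm s t F p : smoothv F -> V p ->
  dopv s (dopv t F) p = dopv t (dopv s F) p.
Proof.
move=> sF Vp; apply/rowP => k; rewrite !mxE.
rewrite (@dop_eq_on _ V _ _ (dop t (fun x => F x 0 k))) //; last first.
  by move=> x _; rewrite mxE.
rewrite (dop_comm _ _ oV (sF k) Vp).
by apply: dop_eq_on oV _ _ Vp => x _; rewrite mxE.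
Qed.

Lemma dopv_conj s F p : smoothv F -> V p ->
  dopv s (fun x => conjv (F x)) p = conjv (dopv (conjc s) F p).
Proof.
move=> sF Vp; apply/rowP => k; rewrite !mxE -(dop_conj _ (sF k) Vp).
by apply: dop_eq_on oV _ _ Vp => x _; rewrite mxE.
Qed.

Lemma dop_bilin s F G p : smoothv F -> smoothv G -> V p ->
  dop s (fun x => bilinC B (F x) (G x)) p =
  bilinC B (dopv s F p) (G p) + bilinC B (F p) (dopv s G p).
Proof.
move=> sF sG Vp.
have sFB i j : smoothC V (fun x => F x 0 i * (B i j)%:C).
  by apply: smoothCM (sF i) _ => //; exact: smoothC_cst.
have sFG i j : smoothC V (fun x => F x 0 i * (B i j)%:C * G x 0 j).
  exact: smoothCM.
rewrite -(@dop_eq_on _ V _ (fun x => \sum_i \sum_j F x 0 i * (B i j)%:C * G x 0 j)) //;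
  last by move=> x _; rewrite bilinC_sum.
rewrite (dop_sum _ oV (fun i => smoothC_sum oV (sFG i)) Vp) !bilinC_sum -big_split /=.
apply: eq_bigr => i _; rewrite (dop_sum _ oV (sFG i) Vp) -big_split /=.
apply: eq_bigr => j _; rewrite (dopM _ oV (sFB i j) (sG j) Vp).
rewrite (dopM _ oV (sF i) (smoothC_cst _ oV) Vp) dop_cst mulr0 addr0.
by rewrite !mxE.
Qed.

(** Each orthogonality relation of the harmonic sequence is differentiated through this lemma to
    give the next one. *)
Lemma dop_bilin_cst s F G c p : smoothv F -> smoothv G ->
  (forall x, V x -> bilinC B (F x) (G x) = c) -> V p ->
  bilinC B (dopv s F p) (G p) + bilinC B (F p) (dopv s G p) = 0.
Proof.
move=> sF sG FGc Vp; rewrite -(dop_bilin _ sF sG Vp) -[RHS](dop_cst s c p).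
exact: dop_eq_on oV FGc _ Vp.
Qed.

End vector_fields.

(** * The harmonic sequence *)

Lemma conjcN (R : rcfType) (x : R[i]) : conjc (- x) = - conjc x.
Proof. exact: rmorphN. Qed.

Lemma conjcM (R : rcfType) (x y : R[i]) : conjc (x * y) = conjc x * conjc y.
Proof. exact: rmorphM. Qed.

Lemma harmonic_seqSS (R : realType) (B : 'M[R]_6) (F : 'rV[R]_2 -> 'rV[R[i]]_6) i :
  let G := harmonic_seq B F i.+1 in
  harmonic_seq B F i.+2 = fun p => dopv (- 'i) G p -
    (bilinC B (dopv (- 'i) G p) (conjv (G p)) / bilinC B (G p) (conjv (G p))) *: G p.
Proof. by move=> G; rewrite -(dz_vecE G). Qed.

Lemma conjc_i (R : rcfType) : conjc ('i%C : R[i]) = - 'i%C.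
Proof. by apply/eqP; rewrite eq_complex /= oppr0 !eqxx. Qed.

Lemma hermitian_norm_real (R : realType) n (B : 'M[R]_n) (x : 'rV[R[i]]_n) :
  B^T = B -> conjc (bilinC B x (conjv x)) = bilinC B x (conjv x).
Proof. by move=> Bs; rewrite bilinC_conj conjvK bilinC_sym. Qed.

Section unit_field.
Variables (R : realType) (B : 'M[R]_6) (V : set 'rV[R]_2).
Variable F : 'rV[R]_2 -> 'rV[R[i]]_6.
Hypotheses (oV : open V) (Bsym : B^T = B) (sF : smoothv V F)
  (Freal : forall p, V p -> conjv (F p) = F p)
  (FF : forall p, V p -> bilinC B (F p) (F p) = 1).
Local Notation D := (dopv (- 'i)).
Local Notation Db := (dopv 'i).

Lemma ortho_unit_dz p : V p -> bilinC B (F p) (D F p) = 0.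
Proof.
move=> Vp; have := dop_bilin_cst oV (- 'i) sF sF FF Vp.
rewrite (bilinC_sym (D F p)) // => /eqP.
by rewrite -mulr2n mulrn_eq0 /= => /eqP.
Qed.

(** The harmonic map equation only makes F_(z zbar) a multiple of F. The factor comes from
    differentiating <F, F_z> = 0 in zbar, where F_zbar is the conjugate of F_z because F is real. *)
Lemma harmonic_coefficient p k : V p -> Db (D F) p = k *: F p ->
  k = - bilinC B (D F p) (conjv (D F p)).
Proof.
move=> Vp kE; have DbF : Db F p = conjv (D F p).
  rewrite -(dopv_eq_on oV 'i Freal Vp) (dopv_conj oV 'i sF Vp).
  by congr (conjv (dopv _ F p)); exact: conjc_i.
have := dop_bilin_cst oV 'i sF (smoothv_dop oV (- 'i) sF) ortho_unit_dz Vp.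
rewrite DbF kE bilinCZr FF // mulr1 bilinC_sym // => /eqP.
by rewrite addrC addr_eq0 => /eqP.
Qed.

End unit_field.

(* [P1], [P2], [P3] are phi_1, phi_2, phi_3 in a coordinate on [V], and the third
   field is the harmonicity of phi. *)
Record isotropic_sequence (R : realType) (B : 'M[R]_6) (V : set 'rV[R]_2)
    (F P1 P2 P3 : 'rV[R]_2 -> 'rV[R[i]]_6) : Prop := IsotropicSequence {
  iso_smooth : smoothv V F;
  iso_real : forall p, V p -> conjv (F p) = F p;
  iso_harmonic : forall p, V p ->
    dopv 'i P1 p = - bilinC B (P1 p) (conjv (P1 p)) *: F p;
  iso_unit : forall p, V p -> bilinC B (F p) (F p) = 1;
  iso_P1 : P1 = dopv (- 'i) F;
  iso_P2 : P2 = fun p => dopv (- 'i) P1 p -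
    (bilinC B (dopv (- 'i) P1 p) (conjv (P1 p)) / bilinC B (P1 p) (conjv (P1 p))) *: P1 p;
  iso_P3 : P3 = fun p => dopv (- 'i) P2 p -
    (bilinC B (dopv (- 'i) P2 p) (conjv (P2 p)) / bilinC B (P2 p) (conjv (P2 p))) *: P2 p;
  iso_h1 : forall p, V p -> bilinC B (P1 p) (conjv (P1 p)) != 0;
  iso_h2 : forall p, V p -> bilinC B (P2 p) (conjv (P2 p)) != 0;
  iso_null1 : forall p, V p -> bilinC B (P1 p) (P1 p) = 0;
  iso_null2 : forall p, V p -> bilinC B (P2 p) (P2 p) = 0
}.

Section harmonic_sequence.
Variables (R : realType) (B : 'M[R]_6) (V : set 'rV[R]_2).
Variables F P1 P2 P3 : 'rV[R]_2 -> 'rV[R[i]]_6.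
Hypotheses (oV : open V) (Bsym : B^T = B) (iso : isotropic_sequence B V F P1 P2 P3).
Local Notation "'< x , y >" := (bilinC B x y) (at level 8, x, y at level 50).
Local Notation D := (dopv (- 'i)).
Local Notation Db := (dopv 'i).
Let h1 p := '<P1 p, conjv (P1 p)>.
Let h2 p := '<P2 p, conjv (P2 p)>.
Let h3 p := '<P3 p, conjv (P3 p)>.
(** The correction coefficients [a] and [b] of the recursion turn out to be the logarithmic
    derivatives (log h_1)_z and (log h_2)_z, by [dz_h1] and [dz_h2]. Their zbar-derivatives are
    therefore the Laplacians that are sought. *)
Let a p := '<D P1 p, conjv (P1 p)> / h1 p.
Let b p := '<D P2 p, conjv (P2 p)> / h2 p.
Let sF := iso_smooth iso.
Let Freal := iso_real iso.
Let FF := iso_unit iso.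
Let P1E := iso_P1 iso.
Let P2E : P2 = fun p => D P1 p - a p *: P1 p := iso_P2 iso.
Let P3E : P3 = fun p => D P2 p - b p *: P2 p := iso_P3 iso.
Let harm : forall p, V p -> Db P1 p = - h1 p *: F p := iso_harmonic iso.
Let h1_neq0 : forall p, V p -> h1 p != 0 := iso_h1 iso.
Let h2_neq0 : forall p, V p -> h2 p != 0 := iso_h2 iso.
Let iso1 := iso_null1 iso.
Let iso2 := iso_null2 iso.

Let ci : conjc ('i : R[i]) = - 'i.
Proof. by apply/eqP; rewrite eq_complex /= oppr0 !eqxx. Qed.

Let cNi : conjc (- 'i : R[i]) = 'i.
Proof. by rewrite -ci conjcK. Qed.

Let sP1 : smoothv V P1.
Proof. by rewrite P1E; exact: smoothv_dop. Qed.

Lemma smoothC_h1 : smoothC V h1.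
Proof. exact: smoothC_bilin (smoothv_conj oV sP1). Qed.

Let sa : smoothC V a.
Proof.
apply: smoothCM => //; last exact: smoothCV smoothC_h1.
exact: smoothC_bilin (smoothv_dop oV _ sP1) (smoothv_conj oV sP1).
Qed.

Let sP2 : smoothv V P2.
Proof.
rewrite P2E; apply: smoothvB => //; first exact: smoothv_dop.
exact: smoothvZ.
Qed.

Lemma smoothC_h2 : smoothC V h2.
Proof. exact: smoothC_bilin (smoothv_conj oV sP2). Qed.

Let sb : smoothC V b.
Proof.
apply: smoothCM => //; last exact: smoothCV smoothC_h2.
exact: smoothC_bilin (smoothv_dop oV _ sP2) (smoothv_conj oV sP2).
Qed.

Lemma smoothv_P3 : smoothv V P3.
Proof.
rewrite P3E; apply: smoothvB => //; first exact: smoothv_dop.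
exact: smoothvZ.
Qed.
Let sP3 := smoothv_P3.

Lemma smoothv_P1 : smoothv V P1. Proof. exact: sP1. Qed.
Lemma smoothv_P2 : smoothv V P2. Proof. exact: sP2. Qed.

Let h1_real p : conjc (h1 p) = h1 p. Proof. exact: hermitian_norm_real. Qed.
Let h2_real p : conjc (h2 p) = h2 p. Proof. exact: hermitian_norm_real. Qed.

Let DP1 p : D P1 p = P2 p + a p *: P1 p.
Proof. by rewrite P2E subrK. Qed.

Let DP2 p : D P2 p = P3 p + b p *: P2 p.
Proof. by rewrite P3E subrK. Qed.

Let DP1c p : V p -> D (fun x => conjv (P1 x)) p = - h1 p *: F p.
Proof.
move=> Vp; rewrite (dopv_conj oV _ sP1 Vp) cNi harm // conjvZ Freal //.
by rewrite conjcN h1_real.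
Qed.

Let DbP1c p : V p -> Db (fun x => conjv (P1 x)) p =
  conjv (P2 p) + conjc (a p) *: conjv (P1 p).
Proof. by move=> Vp; rewrite (dopv_conj oV _ sP1 Vp) ci DP1 conjvD conjvZ. Qed.

Let DbP2c p : V p -> Db (fun x => conjv (P2 x)) p =
  conjv (P3 p) + conjc (b p) *: conjv (P2 p).
Proof. by move=> Vp; rewrite (dopv_conj oV _ sP2 Vp) ci DP2 conjvD conjvZ. Qed.

Lemma orthoF1 p : V p -> '<F p, P1 p> = 0.
Proof. by move=> Vp; rewrite P1E (ortho_unit_dz oV Bsym sF FF Vp). Qed.

Lemma ortho12c p : V p -> '<P2 p, conjv (P1 p)> = 0.
Proof.
by move=> Vp; rewrite P2E bilinCBl bilinCZl divfK ?subrr // h1_neq0.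
Qed.

Lemma ortho23c p : V p -> '<P3 p, conjv (P2 p)> = 0.
Proof.
by move=> Vp; rewrite P3E bilinCBl bilinCZl divfK ?subrr // h2_neq0.
Qed.

(** Isotropy enters here: the z-derivative of <phi_1, phi_1> = 0 is 2 <phi_2 + a phi_1, phi_1>, and
    the term in [a] vanishes. The same argument one step higher gives [ortho23]. *)
Lemma ortho12 p : V p -> '<P2 p, P1 p> = 0.
Proof.
move=> Vp; have := dop_bilin_cst oV (- 'i) sP1 sP1 iso1 Vp.
rewrite (bilinC_sym (P1 p)) // DP1 bilinCDl bilinCZl iso1 // mulr0 addr0 => /eqP.
by rewrite -mulr2n mulrn_eq0 /= => /eqP.
Qed.

Lemma orthoF2 p : V p -> '<F p, P2 p> = 0.
Proof.
move=> Vp; have := dop_bilin_cst oV (- 'i) sF sP1 orthoF1 Vp.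
by rewrite -P1E iso1 // add0r DP1 bilinCDr bilinCZr orthoF1 // mulr0 addr0.
Qed.

Lemma ortho23 p : V p -> '<P3 p, P2 p> = 0.
Proof.
move=> Vp; have := dop_bilin_cst oV (- 'i) sP2 sP2 iso2 Vp.
rewrite (bilinC_sym (P2 p)) // DP2 bilinCDl bilinCZl iso2 // mulr0 addr0 => /eqP.
by rewrite -mulr2n mulrn_eq0 /= => /eqP.
Qed.

Lemma orthoF3 p : V p -> '<F p, P3 p> = 0.
Proof.
move=> Vp; have := dop_bilin_cst oV (- 'i) sF sP2 orthoF2 Vp.
rewrite -P1E (bilinC_sym (P1 p)) // ortho12 // add0r DP2 bilinCDr bilinCZr.
by rewrite orthoF2 // mulr0 addr0.
Qed.

(** The z-derivative of <phi_2, phi_1> = 0; the second condition of isotropy removes the term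
    <phi_2, phi_2>. *)
Lemma ortho13 p : V p -> '<P3 p, P1 p> = 0.
Proof.
move=> Vp; have := dop_bilin_cst oV (- 'i) sP2 sP1 ortho12 Vp.
rewrite DP1 DP2 bilinCDl bilinCDr bilinCZl bilinCZr iso2 // ortho12 //.
by rewrite !mulr0 !addr0.
Qed.

(** The z-derivative of <phi_2, conj phi_1> = 0. By harmonicity (conj phi_1)_z is a multiple of phi,
    to which phi_2 is orthogonal. *)
Lemma ortho13c p : V p -> '<P3 p, conjv (P1 p)> = 0.
Proof.
move=> Vp; have := dop_bilin_cst oV (- 'i) sP2 (smoothv_conj oV sP1) ortho12c Vp.
rewrite DP1c // DP2 bilinCDl bilinCZl ortho12c // bilinCZr.
by rewrite (bilinC_sym (P2 p)) // orthoF2 // !mulr0 !addr0.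
Qed.

Lemma dz_h1 p : V p -> dop (- 'i) h1 p = a p * h1 p.
Proof.
move=> Vp; rewrite (dop_bilin B oV _ sP1 (smoothv_conj oV sP1) Vp).
rewrite DP1 DP1c // bilinCDl bilinCZl ortho12c // add0r.
by rewrite bilinCZr (bilinC_sym (P1 p) (F p)) // orthoF1 // mulr0 addr0.
Qed.

(** Commuting the derivatives gives (phi_1)_(z zbar) = (- h_1 phi)_z. The terms along phi cancel
    because (h_1)_z = a h_1, and only a multiple of phi_1 is left. *)
Let DbP2_aux p : V p -> Db P2 p = - (h1 p + dop 'i a p) *: P1 p.
Proof.
move=> Vp; rewrite P2E (dopvB oV _ (smoothv_dop oV _ sP1) (smoothvZ oV sa sP1) Vp).
rewrite (dopvZ oV _ sa sP1 Vp) (dopv_comm oV _ _ sP1 Vp).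
rewrite (dopv_eq_on oV _ (fun x Vx => harm Vx) Vp).
rewrite (dopvZ oV _ (smoothCN oV smoothC_h1) sF Vp) (dopN _ oV smoothC_h1 Vp).
rewrite dz_h1 // harm // -P1E.
move: (h1 p) (dop 'i a p) (a p) (P1 p) (F p) => x y z u v.
by apply/rowP => k; rewrite !mxE; ring.
Qed.

(** The zbar-derivative of <phi_2, conj phi_1> = 0 reads - (h_1 + a_zbar) h_1 + h_2 = 0, which is
    solved for a_zbar. *)
Lemma dzbar_a p : V p -> dop 'i a p = h2 p / h1 p - h1 p.
Proof.
move=> Vp; have := dop_bilin_cst oV 'i sP2 (smoothv_conj oV sP1) ortho12c Vp.
rewrite DbP2_aux // DbP1c // bilinCDr bilinCZl bilinCZr ortho12c // mulr0 addr0.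
rewrite -/(h1 p) -/(h2 p); move: (h1_neq0 Vp); move: (h1 p) (dop 'i a p) (h2 p) => x y z x0 E.
apply: (mulIf x0); rewrite mulrBl divfK //; apply/eqP; rewrite -subr_eq0.
by rewrite -oppr_eq0 -E; apply/eqP; ring.
Qed.

Lemma dzbar_P2 p : V p -> Db P2 p = - (h2 p / h1 p) *: P1 p.
Proof. by move=> Vp; rewrite DbP2_aux // dzbar_a // subrKC. Qed.

Let DP2c p : V p -> D (fun x => conjv (P2 x)) p = - (h2 p / h1 p) *: conjv (P1 p).
Proof.
move=> Vp; rewrite (dopv_conj oV _ sP2 Vp) cNi dzbar_P2 // conjvZ.
by rewrite conjcN conjcM conjc_inv h1_real h2_real.
Qed.

Lemma dz_h2 p : V p -> dop (- 'i) h2 p = b p * h2 p.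
Proof.
move=> Vp; rewrite (dop_bilin B oV _ sP2 (smoothv_conj oV sP2) Vp).
rewrite DP2 DP2c // bilinCDl bilinCZl ortho23c // add0r.
by rewrite bilinCZr ortho12c // mulr0 addr0.
Qed.

(** As for phi_2: after commuting the derivatives, the terms along phi_1 cancel because (h_2 /
    h_1)_z = (b - a) h_2 / h_1. *)
Let DbP3_aux p : V p -> Db P3 p = - (h2 p / h1 p + dop 'i b p) *: P2 p.
Proof.
move=> Vp; rewrite P3E (dopvB oV _ (smoothv_dop oV _ sP2) (smoothvZ oV sb sP2) Vp).
rewrite (dopvZ oV _ sb sP2 Vp) (dopv_comm oV _ _ sP2 Vp).
rewrite (dopv_eq_on oV _ (fun x Vx => dzbar_P2 Vx) Vp).
have sq := smoothCM oV smoothC_h2 (smoothCV oV h1_neq0 smoothC_h1).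
rewrite (dopvZ oV _ (smoothCN oV sq) sP1 Vp) (dopN _ oV sq Vp).
rewrite (dop_div _ oV smoothC_h2 smoothC_h1 h1_neq0 Vp).
rewrite dz_h1 // dz_h2 // dzbar_P2 // DP1.
move: (h1_neq0 Vp).
move: (h1 p) (h2 p) (dop 'i b p) (a p) (b p) (P1 p) (P2 p) => x y z s t u v x0.
by apply/rowP => k; rewrite !mxE; field.
Qed.

Lemma dzbar_b p : V p -> dop 'i b p = h3 p / h2 p - h2 p / h1 p.
Proof.
move=> Vp; have := dop_bilin_cst oV 'i sP3 (smoothv_conj oV sP2) ortho23c Vp.
rewrite DbP3_aux // DbP2c // bilinCDr bilinCZl bilinCZr ortho23c // mulr0 addr0.
rewrite -/(h2 p) -/(h3 p); move: (h2_neq0 Vp); move: (h2 p / h1 p) (dop 'i b p) (h2 p) (h3 p) => x y z t z0 E.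
apply: (mulIf z0); rewrite mulrBl divfK //; apply/eqP; rewrite -subr_eq0.
by rewrite -oppr_eq0 -E; apply/eqP; ring.
Qed.

(** (phi_3)_zbar is a multiple of phi_2, which is orthogonal to phi_3. *)
Lemma dzbar_P3_sq p : V p -> dop 'i (fun x => '<P3 x, P3 x>) p = 0.
Proof.
move=> Vp; rewrite (dop_bilin B oV _ sP3 sP3 Vp) (bilinC_sym (P3 p)) //.
by rewrite DbP3_aux // bilinCZl (bilinC_sym (P2 p)) // ortho23 // mulr0 addr0.
Qed.

(** The derivative of log h_1 is written as a quotient, so that no complex logarithm is involved and
    the same form serves for the negative function h_2. *)
Lemma dzbar_dz_log_h1 p : V p ->
  dop 'i (fun x => dop (- 'i) h1 x / h1 x) p = h2 p / h1 p - h1 p.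
Proof.
move=> Vp; rewrite -dzbar_a //; apply: dop_eq_on oV _ _ Vp => x Vx.
by rewrite dz_h1 // mulfK ?h1_neq0.
Qed.

Lemma dzbar_dz_log_h2 p : V p ->
  dop 'i (fun x => dop (- 'i) h2 x / h2 x) p =
  h3 p / h2 p - h2 p / h1 p.
Proof.
move=> Vp; rewrite -dzbar_b //; apply: dop_eq_on oV _ _ Vp => x Vx.
by rewrite dz_h2 // mulfK ?h2_neq0.
Qed.

Lemma harmonic_sequence_ortho p : V p ->
  [/\ '<F p, P1 p> = 0, '<F p, P2 p> = 0, '<P2 p, P1 p> = 0 &
      '<P2 p, conjv (P1 p)> = 0] /\
  [/\ '<F p, P3 p> = 0, '<P3 p, P1 p> = 0, '<P3 p, conjv (P1 p)> = 0,
      '<P3 p, P2 p> = 0 & '<P3 p, conjv (P2 p)> = 0].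
Proof.
move=> Vp; split; split.
- exact: orthoF1.
- exact: orthoF2.
- exact: ortho12.
- exact: ortho12c.
- exact: orthoF3.
- exact: ortho13.
- exact: ortho13c.
- exact: ortho23.
- exact: ortho23c.
Qed.

End harmonic_sequence.

(** * Signature and frames *)

Section signature.
Variables (R : realType) (B : 'M[R]_6).
Hypothesis sigB : signature33 B.

(** [P *m B *m P^T] is diagonal, hence equal to its transpose, and the invertible [P] cancels on
    both sides. *)
Lemma signature33_sym : B^T = B.
Proof.
have [P Pu PBP] := sigB.
have PtU : P^T \in unitmx by rewrite unitmx_tr.
apply: (can_inj (mulKmx Pu)); apply: (can_inj (mulmxK PtU)).
by rewrite PBP -[in RHS]tr_diag_mx -PBP !trmx_mul trmxK mulmxA.
Qed.

Lemma signature33_det : \det B < 0.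
Proof.
have [P Pu /(congr1 determinant)] := sigB.
rewrite !det_mulmx det_tr det_diag !big_ord_recl big_ord0 !mxE /= => PBP.
have P2 : 0 < \det P ^+ 2.
  by rewrite lt0r sqr_ge0 andbT expf_neq0 // -unitfE -unitmxE.
rewrite -(pmulr_rlt0 _ P2) expr2 mulrAC PBP.
lra.
Qed.

(* A positive definite 4-dimensional subspace would meet the negative definite
   3-dimensional one. *)
Lemma no_positive_4frame (U : 'M[R[i]]_(4, 6)) (d : 'rV[R[i]]_4) :
  U *m toCmx B *m (map_mx conjc U)^T = diag_mx d ->
  ~ (forall k, 0 < d 0 k).
Proof.
have [P Pu PBP] := sigB; pose Q := toCmx P.
have Qu : Q \in unitmx by rewrite map_unitmx.
move=> UBU d0.
(* The rows of [Y] are the coordinates of the rows of [U] in a basis that diagonalises the form, the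
   three positive directions first. Four rows in three columns are dependent, so some combination
   [c] of the rows of [U] has no positive coordinate. *)
pose Y : 'M[R[i]]_(4, 3 + 3) := U *m invmx Q.
have /rowV0Pn[c cK c0] : kermx (lsubmx Y) != 0.
  rewrite -mxrank_eq0 mxrank_ker subn_eq0 -ltnNge.
  by apply: leq_ltn_trans (rank_leq_col _) _.
have {}cK : c *m lsubmx Y = 0 by apply/sub_kermxP.
pose y : 'rV[R[i]]_6 := c *m Y.
have yQ : y *m Q = c *m U by rewrite /y /Y -!mulmxA mulVmx ?mulmx1.
have y0 (k : 'I_6) : (k < 3)%N -> y 0 k = 0.
  move=> k3; have <- : lshift 3 (Ordinal k3) = k by exact: val_inj.
  have := congr1 (fun A : 'rV_3 => A 0 (Ordinal k3)) cK.
  by rewrite mulmx_lsub !mxE.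
pose J : 'rV[R[i]]_6 := \row_(k < 6) (if (k < 3)%N then 1 else -1).
have QBQ : Q *m toCmx B *m (map_mx conjc Q)^T = diag_mx J.
  have -> : map_mx conjc Q = Q by apply/matrixP => i j; rewrite !mxE conjc_real.
  rewrite -toCmx_tr /Q /toCmx -!map_mxM PBP; apply/matrixP => i j; rewrite !mxE.
  by case: ifP => _; rewrite ?rmorphMn ?rmorphN /= ?rmorph1.
have diagE n (e z : 'rV[R[i]]_n) :
    (z *m diag_mx e *m (map_mx conjc z)^T) 0 0 = \sum_k e 0 k * (z 0 k * conjc (z 0 k)).
  rewrite mxE; apply: eq_bigr => k _.
  by rewrite mul_mx_diag !mxE mulrAC mulrC.
(* The hermitian square of [c *m U] computed in two ways: positive through [d], not positive through
   the last three coordinates of [y]. *)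
have E1 : c *m diag_mx d *m (map_mx conjc c)^T = y *m diag_mx J *m (map_mx conjc y)^T.
  rewrite -UBU -QBQ !mulmxA yQ -[_ *m (map_mx conjc U)^T *m _]mulmxA.
  rewrite -[RHS]mulmxA -!trmx_mul; congr (_ *m trmx _).
  by rewrite -(map_mxM conjc) -(map_mxM conjc) yQ.
have /eqP := congr1 (fun A : 'M[R[i]]_1 => A 0 0) E1; rewrite !diagE.
have [k ck] : exists k, c 0 k != 0.
  apply/existsP; rewrite -negb_forall; apply: contra c0 => /forallP c0.
  by apply/eqP/rowP => k; rewrite mxE; apply/eqP.
apply/negP; rewrite eq_sym lt_eqF //; apply: (@le_lt_trans _ _ 0).
  apply: sumr_le0 => i _; have [i3|i3] := ltnP i 3.
    by rewrite y0 // mul0r mulr0.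
  by rewrite mxE ltnNge i3 /= mulN1r oppr_le0 mulcJ_ge0.
rewrite (bigD1 k) //= ltr_pwDl //; last first.
  by apply: sumr_ge0 => i _; apply: mulr_ge0; [exact: ltW|exact: mulcJ_ge0].
by rewrite mulr_gt0 // lt0r mulcJ_ge0 mulf_neq0 ?conjc_eq0.
Qed.

End signature.

Section frame.
Variables (R : realType) (B : 'M[R]_6).
Implicit Types u v w : 'rV[R[i]]_6.

(** Each vector stands next to its conjugate, so conjugating [v] or [w] is a transposition of
    neighbouring rows. *)
Definition frame u v w x : 'M[R[i]]_6 :=
  \matrix_(i < 6) nth 0 [:: u; v; conjv v; w; conjv w; x] i.

Lemma gram_entry m n (M : 'M[R[i]]_(m, 6)) (N : 'M[R[i]]_(n, 6)) i j :
  (M *m toCmx B *m N^T) i j = bilinC B (row i M) (row j N).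
Proof.
rewrite /bilinC /bilin -row_mul mxE [RHS]mxE; apply: eq_bigr => k _.
by rewrite !mxE.
Qed.

Lemma det_xrow n (i j : 'I_n) (A : 'M[R[i]]_n) : i != j -> \det (xrow i j A) = - \det A.
Proof. by move=> ij; rewrite xrowE det_mulmx det_perm odd_tperm ij expr1 mulN1r. Qed.

Lemma det_frame_conj u v w x :
  \det (frame u (conjv v) (conjv w) x) = \det (frame u v w x).
Proof.
pose o1 : 'I_6 := @Ordinal 6 1 isT; pose o2 : 'I_6 := @Ordinal 6 2 isT.
pose o3 : 'I_6 := @Ordinal 6 3 isT; pose o4 : 'I_6 := @Ordinal 6 4 isT.
have -> : frame u (conjv v) (conjv w) x = xrow o1 o2 (xrow o3 o4 (frame u v w x)).
  apply/matrixP => i j; rewrite !mxE !permE /=.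
  by case: i => [] [|[|[|[|[|[|i]]]]]] //= _; rewrite ?permE /= ?conjvK.
by rewrite !det_xrow ?opprK.
Qed.

(** The exponents are 1 + 2 + 3 from [v], [w], [x] and 1 + 2 from the conjugates of [v] and [w]. *)
Lemma det_frame_scale u v w x l :
  \det (frame u (l *: v) (l ^+ 2 *: w) (l ^+ 3 *: x)) =
  l ^+ 6 * conjc l ^+ 3 * \det (frame u v w x).
Proof.
pose lc := conjc l.
pose d : 'rV[R[i]]_6 := \row_(i < 6) nth 0 [:: 1; l; lc; l ^+ 2; lc ^+ 2; l ^+ 3] i.
have -> : frame u (l *: v) (l ^+ 2 *: w) (l ^+ 3 *: x) = diag_mx d *m frame u v w x.
  apply/row_matrixP => i; rewrite row_mul row_diag_mx -scalemxAl -rowE !rowK mxE.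
  case: i => [] [|[|[|[|[|[|i]]]]]] //= _.
  - by rewrite scale1r.
  - by rewrite conjvZ.
  - by rewrite conjvZ rmorphXn.
rewrite det_mulmx det_diag !big_ord_recl big_ord0 !mxE /= /lc.
by congr (_ * _); ring.
Qed.

(** An isotropic vector pairs nontrivially only with its conjugate, so conjugating [v] and [w] in
    the second frame makes the Gram matrix diagonal. The last vectors are independent of each other:
    [y = x] will give q^2 and [y = conjv x] will give |q|^2. *)
Lemma det_frame_gram u v w x y :
  bilinC B u u = 1 -> B^T = B -> conjv u = u ->
  [/\ bilinC B v v = 0, bilinC B w w = 0, bilinC B u v = 0 & bilinC B u w = 0] ->
  bilinC B w v = 0 -> bilinC B w (conjv v) = 0 ->
  [/\ bilinC B u x = 0, bilinC B x v = 0, bilinC B x (conjv v) = 0,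
      bilinC B x w = 0 & bilinC B x (conjv w) = 0] ->
  [/\ bilinC B u y = 0, bilinC B y v = 0, bilinC B y (conjv v) = 0,
      bilinC B y w = 0 & bilinC B y (conjv w) = 0] ->
  \det (frame u v w x) * (\det B)%:C * \det (frame u (conjv v) (conjv w) y) =
  (bilinC B v (conjv v) * bilinC B w (conjv w)) ^+ 2 * bilinC B x y.
Proof.
move=> uu Bs ur [vv ww uv uw] wv wvc [ux xv xvc xw xwc] [uy yv yvc yw ywc].
have sym (a b : 'rV[R[i]]_6) : bilinC B a b = bilinC B b a by exact: bilinC_sym.
have cj (a b : 'rV[R[i]]_6) : bilinC B a b = 0 -> bilinC B (conjv a) (conjv b) = 0.
  by move=> ab; rewrite -bilinC_conj ab conjc0.
have vvc := cj _ _ vv; have wwc := cj _ _ ww.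
have uvc := cj _ _ uv; have uwc := cj _ _ uw; rewrite ur in uvc uwc.
have wcvc := cj _ _ wv; have wcv := cj _ _ wvc; rewrite conjvK in wcv.
clear cj; set hv := bilinC B v (conjv v); set hw := bilinC B w (conjv w).
have G : frame u v w x *m toCmx B *m (frame u (conjv v) (conjv w) y)^T =
    diag_mx (\row_(i < 6) nth 0 [:: 1; hv; hv; hw; hw; bilinC B x y] i).
  apply/matrixP => i j; rewrite gram_entry !rowK !mxE -(inj_eq val_inj).
  rewrite /hv /hw; case: i j => [i i6] [j j6] /=.
  move: (bilinC B) sym uu vv ww uv uw wv wvc ux xv xvc xw xwc uy yv yvc yw ywc
    vvc wwc uvc uwc wcvc wcv => f sym uu vv ww uv uw wv wvc ux xv xvc xw xwc uy yv
    yvc yw ywc vvc wwc uvc uwc wcvc wcv.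
  case: i i6 => [|[|[|[|[|[|i]]]]]] //= _; case: j j6 => [|[|[|[|[|[|j]]]]]] //= _;
    rewrite ?conjvK ?mulr1n ?mulr0n //; by [|rewrite sym].
have <- : \det (toCmx B) = (\det B)%:C by rewrite -det_map_mx.
rewrite -(det_tr (frame u (conjv v) (conjv w) y)) -!det_mulmx G det_diag.
by rewrite !big_ord_recl big_ord0 !mxE /=; ring.
Qed.

End frame.

(** * Holomorphic functions *)

Section chain_rule.
Variable R : realType.
Local Notation E := 'rV[R]_2.

Lemma ord2E (i : 'I_2) : i = 0 \/ i = 1.
Proof. by case: i => [] [|[|i]] //= i2; [left|right]; exact: val_inj. Qed.

Lemma diff_rV2 (f : E -> R^o) p v : differentiable f p ->
  'd f p v = v 0 0 * partial 0 f p + v 0 1 * partial 1 f p.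
Proof.
move=> df; rewrite /partial !(deriveE _ df) [in LHS](row_sum_delta v).
have l1 : lift ord0 ord0 = 1 :> 'I_2 by exact: val_inj.
by rewrite linear_sum big_ord_recl big_ord1 !linearZ /= l1.
Qed.

Lemma partial_comp k (f : E -> R^o) (t : E -> E) p :
  differentiable t p -> differentiable f (t p) ->
  partial k (f \o t : E -> R^o) p =
  partial k (fun x => t x 0 0 : R^o) p * partial 0 f (t p) +
  partial k (fun x => t x 0 1 : R^o) p * partial 1 f (t p).
Proof.
move=> dt df; have dc := differentiable_comp dt df.
rewrite {1}/partial (deriveE _ dc) (diff_comp dt df) /= (diff_rV2 _ df).
by rewrite -(deriveE _ dt) (derive_mx (diff_derivable dt)) !mxE.
Qed.

End chain_rule.

Section holomorphy.
Variable R : realType.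
Local Notation E := 'rV[R]_2.
Implicit Types V : set E.

Lemma partialC_real k (f : E -> R) p :
  partialC k (fun x => (f x)%:C) p = (partial k (f : E -> R^o) p)%:C.
Proof. by apply/eqP; rewrite eq_complex /= /partial derive_cst !eqxx. Qed.

Lemma dop_ln V s (f : E -> R) p : smooth_on V (f : E -> R^o) -> V p -> 0 < f p ->
  dop s (fun x => (ln (f x))%:C) p = dop s (fun x => (f x)%:C) p / (f p)%:C.
Proof.
move=> sf Vp f0; have df := smooth_diff sf Vp.
have pl k : partial k ((fun x => ln (f x)) : E -> R^o) p =
    (f p)^-1 * partial k (f : E -> R^o) p.
  exact: (partial_comp1 k df (is_derive1_ln f0)).
rewrite /dop !partialC_real (pl 0) (pl 1).
move: (partial 0 (f : E -> R^o) p) (partial 1 (f : E -> R^o) p) => a b.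
by rewrite !rmorphM fmorphV /=; ring.
Qed.

(** Since (f^2)_zbar = 2 f f_zbar, [f] vanishes wherever f_zbar does not. If f_zbar were nonzero at
    [p], it would be so near [p] by continuity; then [f] would be zero near [p], and f_zbar as
    well. *)
Lemma dzbar_sqr_eq0 V f : open V -> smoothC V f ->
  (forall p, V p -> dop 'i (fun x => f x ^+ 2) p = 0) ->
  forall p, V p -> dop 'i f p = 0.
Proof.
move=> oV sf f2 p Vp; apply/eqP; apply: contraT => df0.
have fdf x : V x -> dop 'i f x != 0 -> f x = 0.
  move=> Vx dx; have := f2 x Vx; rewrite (dopM _ oV sf sf Vx) mulrC -mulr2n => /eqP.
  by rewrite mulrn_eq0 /= mulf_eq0 (negPf dx) orbF => /eqP.
have [sr si] := smoothC_dop 'i oV sf.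
have near0 (g : E -> R^o) : smooth_on V g -> g p != 0 -> \forall x \near p, g x != 0.
  move=> sg g0; have := cvgr_neq0 _ (differentiable_continuous (smooth_diff sg Vp)) g0.
  exact.
have nd : \forall x \near p, dop 'i f x != 0.
  move: df0; rewrite eq_complex negb_and => /orP[/(near0 _ sr)|/(near0 _ si)];
    by apply: filterS => x; apply: contraNneq => ->; rewrite eqxx.
have nf : nbhs p [set x | f x = 0].
  have nV : nbhs p V by exact: open_nbhs_nbhs.
  by apply: filterS (filterI nV nd) => x [Vx]; exact: fdf.
have f0 x : interior [set y | f y = 0] x -> f x = 0 by exact: interior_subset.
by move: df0; rewrite (dop_eq_on 'i (@open_interior _ _) f0 nf) dop_cst eqxx.
Qed.

Lemma toCK (p : E) : ofC (toC p) = p.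
Proof. by apply/rowP => k; rewrite mxE; have [->|->] := ord2E k. Qed.

Lemma ofCD (z w : R[i]) : ofC (z + w) = ofC z + ofC w.
Proof.
apply/rowP => k; rewrite !mxE; case: z w => [? ?] [? ?] /=.
by case: ifP.
Qed.

Lemma normc_le_ReIm (z : R[i]) (c : R) : `|complex.Re z| <= c -> `|complex.Im z| <= c ->
  `|z| <= (2 * c)%:C.
Proof.
have normR (x : R) : `|x%:C| = `|x|%:C :> R[i].
  by rewrite normc_def /= expr0n addr0 sqrtr_sqr.
move=> rc ic; rewrite [z]complexE (le_trans (ler_normD _ _)) // normrM !normR.
have -> : `|'i%C| = 1 :> R[i] by rewrite normc_def /= expr0n add0r expr1n sqrtr1.
by rewrite mul1r mulrDl mul1r rmorphD lerD // lecR.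
Qed.

(** The norm on row vectors is the maximum of the coordinates, each of which is bounded by the
    modulus. *)
Lemma norm_ofC_le (z : R[i]) (c : R) : `|z| <= c%:C -> `|ofC z| <= c.
Proof.
move=> zc; have c0 : 0 <= c by rewrite -ler0c (le_trans _ zc).
have rc : `|complex.Re z| <= c by rewrite -lecR (le_trans (normc_ge_Re _)).
have ic : `|complex.Im z| <= c.
  rewrite -normrN -ReiNIm -lecR (le_trans (normc_ge_Re _)) // normrM.
  have -> : `|'i%C| = 1 :> R[i] by rewrite normc_def /= expr0n add0r expr1n sqrtr1.
  by rewrite mulr1.
rewrite /Num.Def.normr /= mx_normrE (bigmax_le _ c0) //= => -[i j] _ /=.
by rewrite mxE; case: ifP.
Qed.

(** Multiplication by the complex derivative [u +i* v] read on real parts: by the Cauchy-Riemann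
    equations [u] and [- v] are the two partial derivatives of Re f. *)
Lemma Re_linear_error (a b h : R[i]) (u v : R) :
  complex.Re (a - b - (u +i* v) * h) =
  complex.Re a - complex.Re b - (complex.Re h * u + complex.Im h * - v).
Proof. by case: a b h => [a a'] [b b'] [h h'] /=; ring. Qed.

Lemma Im_linear_error (a b h : R[i]) (u v : R) :
  complex.Im (a - b - (u +i* v) * h) =
  complex.Im a - complex.Im b - (complex.Re h * v + complex.Im h * u).
Proof. by case: a b h => [a a'] [b b'] [h h'] /=; ring. Qed.

Lemma quotient_dist_le (A L h e : R[i]) : h != 0 ->
  `|A - L * h| <= e * `|h| -> `|L - h^-1 * A| <= e.
Proof.
move=> h0 AL; have -> : L - h^-1 * A = - (h^-1 * (A - L * h)).
  by rewrite mulrBr opprB mulrCA mulVf // mulr1.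
by rewrite normrN normrM normfV ler_pdivrMl ?normr_gt0 // (mulrC `|h|).
Qed.

(** The Cauchy-Riemann equations make the real differential the multiplication by [L], the
    derivative of [f] along x, so the first-order expansions of Re f and Im f combine into a complex
    one. *)
Lemma holomorphic_of_dzbar V f : open V -> smoothC V f ->
  (forall p, V p -> dop 'i f p = 0) -> holomorphic_on V f.
Proof.
move=> oV [sr si] f0 p Vp.
have dr := smooth_diff sr Vp; have di := smooth_diff si Vp.
have CR : partialC 1 f p = 'i * partialC 0 f p.
  have /eqP := f0 p Vp; rewrite /dop mulf_eq0 invr_eq0 pnatr_eq0 orbF addr_eq0 => /eqP ->.
  by rewrite mulrN mulrA -expr2 sqr_i mulN1r opprK.
have [CRr CRi] : partial 1 ((fun x => complex.Re (f x)) : E -> R^o) p =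
    - partial 0 ((fun x => complex.Im (f x)) : E -> R^o) p /\
    partial 1 ((fun x => complex.Im (f x)) : E -> R^o) p =
    partial 0 ((fun x => complex.Re (f x)) : E -> R^o) p.
  case: CR => -> ->; move: (partial 0 _ p) (partial 0 _ p) => u w.
  by split; ring.
set L := partialC 0 f p; apply/cvg_ex; exists L; apply/cvgrPdist_le => /= e e0.
(* A positive [e] in [R[i]] is real. Its half bounds the relative error of each of the two parts,
   and [normc_le_ReIm] adds them up. *)
have [d de d0] : exists2 d : R, e = (2 * d)%:C & 0 < d.
  exists (complex.Re e / 2); last first.
    by rewrite divr_gt0 //; move: e0; rewrite ltcE => /andP[].
  by rewrite mulrC divfK // RRe_real // gtr0_real.
pose Q (g : E -> R^o) (v : E) :=
  `|g (v + p) - g p - (v 0 0 * partial 0 g p + v 0 1 * partial 1 g p)| <= d * `|v|.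
have nr (g : E -> R^o) : differentiable g p -> \forall v \near (0 : E), Q g v.
  move=> dg; have /diff_locally/eqaddoP/(_ d d0) := dg.
  apply: filterS => v; rewrite /Q !fctE /= opprD addrA -(diff_rV2 v dg).
  exact.
have /nbhs_ballP[r /= r0 rP] : \forall v \near (0 : E), Q (fun x => complex.Re (f x)) v /\
    Q (fun x => complex.Im (f x)) v by exact: filterI (nr _ dr) (nr _ di).
have hpos : 0 < (r / 2)%:C by rewrite -[0]/(0%:C) ltcR divr_gt0.
have N1 := @nbhs_dnbhs_neq R[i]^o 0.
have N2 := @dnbhs0_lt R[i] R[i]^o _ hpos.
apply: filterS (filterI N1 N2) => h [/= h0 hr].
have [n hn] : exists n : R, `|h| = n%:C by eexists; exact: normc_def.
have vn : `|ofC h| <= n by apply: norm_ofC_le; rewrite hn.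
have [] := rP (ofC h).
  rewrite -ball_normE /= sub0r normrN (le_lt_trans vn) //.
  move: hr; rewrite hn ltcR => /lt_trans; apply.
  by rewrite ltr_pdivrMr // ltr_pMr // ltr1n.
rewrite /Q CRr CRi => rh ih.
have {rh}rh := le_trans rh (ler_wpM2l (ltW d0) vn).
have {ih}ih := le_trans ih (ler_wpM2l (ltW d0) vn).
rewrite /GRing.scale /= mulr1 ofCD toCK.
set A := f (ofC h + p) - f p.
apply: (@quotient_dist_le A L h e h0); rewrite hn de -rmorphM /= -mulrA.
apply: normc_le_ReIm.
  by move: rh; rewrite !mxE /= -Re_linear_error.
by move: ih; rewrite !mxE /= -Im_linear_error.
Qed.

End holomorphy.

(** * Conformal harmonic maps *)

(** The identity 4 d/dzbar d/dz = Laplacian, with [x], [y], [z] for F_xx, F_xy, F_yy and [w] for the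
    imaginary unit. *)
Lemma laplacian_combination (R : realType) n (w : R[i]) (x y z : 'rV[R]_n) :
  w * w = -1 ->
  2^-1 *: (2^-1 *: (toCmx x + w *: toCmx y)) -
    (w / 2) *: (2^-1 *: (toCmx y + w *: toCmx z)) =
  4^-1 *: toCmx (x + z).
Proof.
move=> ww; apply/rowP => k; rewrite !mxE rmorphD /=.
move: (x 0 k)%:C (y 0 k)%:C (z 0 k)%:C => {}x {}y {}z.
transitivity (4^-1 * (x - (w * w) * z)); first by field.
by rewrite ww mulN1r opprK.
Qed.

Lemma sum_ord2 (M : nmodType) (f : 'I_2 -> M) : \sum_(j < 2) f j = f 0 + f 1.
Proof. by rewrite big_ord_recl big_ord1; congr (_ + f _); exact: val_inj. Qed.

Section real_maps.
Variables (R : realType) (n : nat) (V : set 'rV[R]_2).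
Local Notation E := 'rV[R]_2.
Variable oV : open V.
Implicit Types F : E -> 'rV[R]_n.

Lemma smooth_partial F k : smooth_on V F -> smooth_on V (partial k F).
Proof. by move=> sF j; have [_ /(_ k)] := sF j.+1. Qed.

Lemma smooth_on_diff F p : smooth_on V F -> V p -> differentiable F p.
Proof. by move=> /(_ 1%N) [dF _]; exact: dF. Qed.

Lemma partial_coord F k i p : smooth_on V F -> V p ->
  partial k ((fun x => F x 0 i) : E -> R^o) p = partial k F p 0 i.
Proof.
move=> sF Vp; rewrite /partial (derive_mx (diff_derivable (smooth_on_diff sF Vp))).
by rewrite mxE.
Qed.

Lemma smoothv_toCmx F : smooth_on V F -> smoothv V (fun x => toCmx (F x)).
Proof.
move=> sF k; apply: smoothC_eq_on oV _ (smoothC_real oV (fun j => Ck_coord k oV (sF j))).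
by move=> x _; rewrite mxE.
Qed.

Lemma dopv_toCmx s F p : smooth_on V F -> V p ->
  dopv s (fun x => toCmx (F x)) p =
  2^-1 *: (toCmx (partial 0 F p) + s *: toCmx (partial 1 F p)).
Proof.
move=> sF Vp; apply/rowP => i; rewrite !mxE -(partial_coord 0 i sF Vp) -(partial_coord 1 i sF Vp).
rewrite (@dop_eq_on _ V _ _ (fun x => (F x 0 i)%:C)) //; last by move=> x _; rewrite mxE.
by rewrite /dop !partialC_real mulrC.
Qed.

Lemma partial_schwarz_rV F p : smooth_on V F -> V p ->
  partial 1 (partial 0 F) p = partial 0 (partial 1 F) p.
Proof.
move=> sF Vp; apply/rowP => i.
pose Fi : E -> R^o := fun x => F x 0 i.
have sFi : smooth_on V Fi by move=> j; exact: Ck_coord.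
have D k j : partial k (partial j F) p 0 i = partial k (partial j Fi) p.
  rewrite -(partial_coord k i (smooth_partial j sF) Vp).
  by apply: partial_eq_on oV _ _ Vp => x Vx; rewrite -(partial_coord j i sF Vx).
etransitivity; first exact: (D 1 0).
symmetry; etransitivity; first exact: (D 0 1).
exact: (partial_schwarz 0 1 oV sFi Vp).
Qed.

Lemma dzbar_dz_toCmx F p : smooth_on V F -> V p ->
  dopv 'i (dopv (- 'i) (fun x => toCmx (F x))) p =
  4^-1 *: toCmx (partial 0 (partial 0 F) p + partial 1 (partial 1 F) p).
Proof.
move=> sF Vp; have s0 := smooth_partial 0 sF; have s1 := smooth_partial 1 sF.
have v0 := smoothv_toCmx s0; have v1 := smoothv_toCmx s1.
pose G x := 2^-1 *: toCmx (partial 0 F x) - ('i / 2) *: toCmx (partial 1 F x).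
have FG x : V x -> dopv (- 'i) (fun x => toCmx (F x)) x = G x.
  move=> Vx; rewrite (dopv_toCmx _ sF Vx) /G scalerDr !scalerA.
  by rewrite mulrN mulrC scaleNr.
have e0 := dopv_toCmx 'i s0 Vp; have e1 := dopv_toCmx 'i s1 Vp.
rewrite (partial_schwarz_rV sF Vp) in e0.
etransitivity; first exact: (dopv_eq_on oV 'i FG Vp).
etransitivity; first exact: (dopv_lincomb oV 'i 2^-1 ('i / 2) v0 v1 Vp).
etransitivity; first exact: (f_equal2 (fun X Y => 2^-1 *: X - ('i / 2) *: Y) e0 e1).
by apply: laplacian_combination; rewrite -expr2 sqr_i.
Qed.

(** In dimension two the square root of the determinant of [g] is [l], which cancels the factor of
    the inverse metric; only the outer [1 / l] survives. *)
Lemma laplace_beltrami_conformal (g : E -> 'M[R]_2) (l : E -> R) F p :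
  smooth_on V F -> (forall x, V x -> 0 < l x /\ g x = (l x)%:M) -> V p ->
  laplace_beltrami g F p =
  (l p)^-1 *: (partial 0 (partial 0 F) p + partial 1 (partial 1 F) p).
Proof.
move=> sF gl Vp.
have detg x : V x -> Num.sqrt (\det (g x)) = l x.
  by move=> Vx; have [l0 ->] := gl x Vx; rewrite det_scalar sqrtr_sqr gtr0_norm.
rewrite /laplace_beltrami detg //; congr (_ *: _).
have E j k : partial j (fun x => (Num.sqrt (\det (g x)) * invmx (g x) j k) *:
    partial k F x) p = if j == k then partial j (partial k F) p else 0.
  have -> : (if j == k then partial j (partial k F) p else 0) =
      partial j (fun x => if j == k then partial k F x else 0) p.
    by case: ifP => // _; rewrite /partial derive_cst.
  apply: partial_eq_on oV _ _ Vp => x Vx; rewrite detg //.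
  have [l0 ->] := gl x Vx; rewrite invmx_scalar mxE mulrnAr (mulfV (lt0r_neq0 l0)).
  by case: (j == k); rewrite ?mulr1n ?mulr0n ?scale1r ?scale0r.
transitivity (\sum_(j < 2) partial j (partial j F) p).
  apply: eq_bigr => j _; rewrite (bigD1 j) //= big1 ?addr0 => [|k kj].
    by rewrite (E j j) eqxx.
  by rewrite (E j k) eq_sym (negPf kj).
exact: (sum_ord2 (fun j => partial j (partial j F) p)).
Qed.

End real_maps.

(** With [u = F_x], [v = F_y] and [w = - 'i], the vector is F_z and its hermitian norm is (<F_x,
    F_x> + <F_y, F_y>) / 4. *)
Lemma hermitian_norm_isothermal (R : realType) n (B : 'M[R]_n) (u v : 'rV[R]_n)
    (l : R) (w : R[i]) :
  conjc w = - w -> w * w = -1 -> bilin B u u = l -> bilin B v v = l ->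
  bilin B u v = 0 -> bilin B v u = 0 ->
  bilinC B (2^-1 *: (toCmx u + w *: toCmx v))
    (conjv (2^-1 *: (toCmx u + w *: toCmx v))) = l%:C / 2.
Proof.
move=> cw ww uu vv uv vu.
have c2 : conjc (2^-1 : R[i]) = 2^-1 by rewrite conjc_inv conjc_nat.
rewrite conjvZ conjvD conjvZ !conjv_real cw c2.
have a2 : (2^-1 : R[i]) * 2 = 1 by rewrite mulVf ?pnatr_eq0.
move: (2^-1 : R[i]) a2 => a a2.
rewrite bilinCZl bilinCZr !(bilinCDl, bilinCDr) !(bilinCZl, bilinCZr).
rewrite !bilinC_real uu vv uv vu.
transitivity (a * a * (1 - w * w) * l%:C); first by ring.
by rewrite ww opprK -[1 + 1]/(2 : R[i]) -(mulrA a) a2 mulr1 mulrC.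
Qed.

Section conformal_minimal.
Variables (R : realType) (B : 'M[R]_6) (V : set 'rV[R]_2).
Local Notation E := 'rV[R]_2.
Variables (F : E -> 'rV[R]_6).
Hypotheses (oV : open V) (Bsym : B^T = B) (sF : smooth_on V F).
Hypothesis (FQ : forall p, V p -> bilin B (F p) (F p) = 1).
Hypothesis (conf : forall p, V p ->
  exists2 l : R, 0 < l & induced_metric B F p = l%:M).
Local Notation FC := (fun p => toCmx (F p)).
Local Notation P1 := (dopv (- 'i) FC).

Lemma induced_metricE p i j : V p ->
  induced_metric B F p i j = bilin B (partial i F p) (partial j F p).
Proof.
move=> Vp; have rJ k : row k ('J F p) = partial k F p.
  by rewrite rowE /partial (deriveEjacobian _ (smooth_on_diff sF Vp)).
rewrite /induced_metric /bilin -!rJ -row_mul mxE [RHS]mxE; apply: eq_bigr => k _.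
by rewrite !mxE.
Qed.

Lemma dz_hermitian_norm_gt0 p : V p -> exists2 l : R, 0 < l &
  bilinC B (P1 p) (conjv (P1 p)) = l%:C.
Proof.
move=> Vp; have [l l0 gl] := conf Vp; exists (l / 2); first by rewrite divr_gt0.
have g i j : bilin B (partial i F p) (partial j F p) = l *+ (i == j).
  by rewrite -induced_metricE // gl mxE.
have E := dopv_toCmx oV (- 'i) sF Vp.
etransitivity; first exact: (congr1 (fun x => bilinC B x (conjv x)) E).
have cNi : conjc (- 'i : R[i]) = - - 'i.
  rewrite conjcN; congr (- _); exact: conjc_i.
have Ni2 : (- 'i) * (- 'i) = -1 :> R[i] by rewrite mulrNN -expr2; exact: sqr_i.
etransitivity.
  exact: (hermitian_norm_isothermal cNi Ni2 (g 0 0) (g 1 1) (g 0 1) (g 1 0)).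
by rewrite rmorphM fmorphV rmorph_nat.
Qed.

(** Vanishing tension makes the Laplacian equal to its normal component, a multiple of F. The factor
    stays unspecified here, as [harmonic_coefficient] determines it. *)
Lemma conformal_harmonic p : V p -> tension B F p = 0 ->
  exists k : R[i], dopv 'i P1 p = k *: FC p.
Proof.
move=> Vp; rewrite /tension.
(* The conformal factor is chosen point by point; the value 1 outside [V] is arbitrary. *)
pose l x := if pselect (V x) is left Vx then sval (cid2 (conf Vx)) else 1.
have lP x : V x -> 0 < l x /\ induced_metric B F x = (l x)%:M.
  by rewrite /l; case: pselect => // Vx _; case: cid2.
rewrite (laplace_beltrami_conformal oV sF lP Vp) => /eqP; rewrite subr_eq0.
have [l0 _] := lP _ Vp.
have := dzbar_dz_toCmx oV sF Vp; move: (partial 0 _ p + partial 1 _ p) => L LE.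
move: (bilin _ _ _) => k /eqP Lk.
exists (4^-1 * (l p * k)%:C); apply: (etrans LE); rewrite -scalerA; congr (_ *: _).
have -> : L = (l p * k) *: F p by rewrite -scalerA -Lk scalerA divff ?gt_eqF // scale1r.
by apply/rowP => i; rewrite !mxE rmorphM.
Qed.

End conformal_minimal.

(** * Changes of coordinate *)

Section transition_maps.
Variable R : realType.
Local Notation E := 'rV[R]_2.

Lemma chart_imP (M : topologicalType) (c : chart R M) p :
  chart_im c p -> chart_dom c (chart_inv c p) /\ chart_map c (chart_inv c p) = p.
Proof. by move=> [x cx <-]; rewrite chart_mapK. Qed.

Lemma overlapE (M : topologicalType) (c c' : chart R M) :
  overlap c c' = chart_im c `&` (chart_inv c @^-1` chart_dom c').
Proof.
apply/seteqP; split=> p; last first.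
  move=> [/chart_imP[cp pE] c'p]; exists (chart_inv c p) => //; split.
by move=> [x [cx c'x] <-]; split; [exists x|rewrite /= chart_mapK].
Qed.

Lemma open_overlap (M : topologicalType) (c c' : chart R M) : open (overlap c c').
Proof.
rewrite overlapE openE => p [Vp c'p].
have oV : open (chart_im c) by exact: chart_im_open.
have /(_ p) cf : {in chart_im c, continuous (chart_inv c)}.
  by rewrite -continuous_open_subspace //; exact: chart_inv_cont.
apply: filterI; first exact: open_nbhs_nbhs.
apply: cf; first exact/mem_set.
by apply: open_nbhs_nbhs; split=> //; exact: chart_dom_open.
Qed.

Lemma overlap_transition (M : topologicalType) (c c' : chart R M) p :
  overlap c c' p -> chart_im c' (transition c c' p) /\
  chart_inv c' (transition c c' p) = chart_inv c p.
Proof.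
move=> [x [cx c'x] <-]; rewrite /transition /= !chart_mapK //; split=> //.
by exists x.
Qed.

Lemma jacobian_entry n (f : E -> 'rV[R]_n) p i j : differentiable f p ->
  'J f p i j = partial i f p 0 j.
Proof. by move=> df; rewrite /partial (deriveEjacobian _ df) -rowE [RHS]mxE. Qed.

Lemma jacobian_comp n (t : E -> E) (f : E -> 'rV[R]_n) p :
  differentiable t p -> differentiable f (t p) ->
  'J (f \o t) p = 'J t p *m 'J f (t p).
Proof.
move=> dt df; apply/row_matrixP => i.
rewrite row_mul !rowE -(deriveEjacobian _ (differentiable_comp dt df)).
rewrite (deriveE _ (differentiable_comp dt df)) (diff_comp dt df) /=.
by rewrite -(deriveE _ dt) -(deriveE _ df) !deriveEjacobian.
Qed.

(** Lagrange's identity gives determinant^2 = m^2, and positivity selects the root m. Then (a - d)^2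
    + (b + c)^2 = 2 m - 2 m = 0. *)
Lemma conformal_rows (m a b c d : R) : 0 < m ->
  a * a + b * b = m -> c * c + d * d = m -> a * c + b * d = 0 ->
  0 < a * d - b * c -> c = - b /\ d = a.
Proof.
move=> m0 ab cd acbd det0.
have E1 : (a * d - b * c) ^+ 2 = m ^+ 2.
  transitivity ((a * a + b * b) * (c * c + d * d) - (a * c + b * d) ^+ 2); first by ring.
  by rewrite ab cd acbd expr2 mul0r subr0 expr2.
have {}E1 : a * d - b * c = m by apply: (pexpIrn (_ : 0 < 2)%N) => //; rewrite nnegrE ltW.
have E2 : (a - d) ^+ 2 + (b + c) ^+ 2 = 0.
  transitivity ((a * a + b * b) + (c * c + d * d) - 2 * (a * d - b * c)); first by ring.
  by rewrite ab cd E1; ring.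
move/eqP: E2; rewrite paddr_eq0 ?sqr_ge0 // !sqrf_eq0 subr_eq0 addr_eq0.
by move=> /andP[/eqP -> /eqP ->]; rewrite opprK.
Qed.

Lemma det_mx22 (M : 'M[R]_2) : \det M = M 0 0 * M 1 1 - M 0 1 * M 1 0.
Proof.
have l00 : lift 0 0 = 1 :> 'I_2 by exact: val_inj.
have l10 : lift 1 0 = 0 :> 'I_2 by exact: val_inj.
rewrite (expand_det_row _ 0) sum_ord2 /cofactor !det_mx11 !mxE l00 l10.
by rewrite expr0 expr1 mul1r mulN1r mulrN.
Qed.

(** Two isothermal coordinates for one metric give T T^t = (l / l') I, and an oriented such matrix
    satisfies the Cauchy-Riemann equations. *)
Lemma conformal_jacobian (T : 'I_2 -> 'I_2 -> R) (l l' : R) : 0 < l -> 0 < l' ->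
  (forall i j, l *+ (i == j) = l' * \sum_k T i k * T j k) ->
  0 < \det (\matrix_(i, j) T i j) ->
  (T 1 0 = - T 0 1 /\ T 1 1 = T 0 0) /\ 0 < T 0 0 * T 0 0 + T 0 1 * T 0 1.
Proof.
move=> l0 l'0 TT; rewrite det_mx22 !mxE => det0.
have n0 : l / l' * l' = l by rewrite divfK ?gt_eqF.
have m0 : 0 < l / l' by rewrite divr_gt0.
have E i j : T i 0 * T j 0 + T i 1 * T j 1 = (l / l') *+ (i == j).
  apply: (mulfI (lt0r_neq0 l'0)); rewrite -(sum_ord2 (fun k => T i k * T j k)).
  by rewrite -TT mulrnAr (mulrC l') n0.
have E01 : T 0 0 * T 1 0 + T 0 1 * T 1 1 = 0 by rewrite (E 0 1).
split; last by rewrite (E 0 0).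
by apply: (conformal_rows m0 (E 0 0) (E 1 1) E01).
Qed.

End transition_maps.

Lemma complex_lincomb (R : rcfType) (a b u u' v v' : R) :
  (a * u + b * v) +i* (a * u' + b * v') = a%:C * (u +i* u') + b%:C * (v +i* v').
Proof. by apply/eqP; rewrite eq_complex /= !mul0r !subr0 !addr0 !eqxx. Qed.

Section conformal_change.
Variables (R : realType) (U V' : set 'rV[R]_2) (t : 'rV[R]_2 -> 'rV[R]_2).
Local Notation E := 'rV[R]_2.
Hypotheses (oU : open U) (oV' : open V') (st : smooth_on U t).
Hypotheses (tUV : forall p, U p -> V' (t p)).
Hypothesis tCR : forall p, U p ->
  partial 1 t p 0 0 = - partial 0 t p 0 1 /\ partial 1 t p 0 1 = partial 0 t p 0 0.

Let lam : E -> R[i] := dop (- 'i) (fun x => toC (t x)).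

Lemma smoothC_toC : smoothC U (fun x => toC (t x)).
Proof. by split=> k; exact: Ck_coord. Qed.

Lemma dz_transition p : U p -> lam p = partial 0 t p 0 0 +i* partial 0 t p 0 1.
Proof.
move=> Up; have [e0 e1] := tCR Up.
have pE k : partialC k (fun x => toC (t x)) p = partial k t p 0 0 +i* partial k t p 0 1.
  rewrite -(partial_coord k 0 st Up) -(partial_coord k 1 st Up).
  by [].
have pE1 := etrans (pE 1) (f_equal2 (@Complex _) e0 e1).
apply: (etrans (f_equal2 (fun x y => (x + - 'i * y) / 2%:R) (pE 0) pE1)).
move: (partial 0 t p 0 0) (partial 0 t p 0 1) => a b.
have -> : (- 'i) * (- b +i* a) = a +i* b :> R[i].
  by apply/eqP; rewrite eq_complex /=; apply/andP; split; apply/eqP; ring.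
by move: (a +i* b) => z; field.
Qed.

(** The chain rule also has a term in f_wbar, whose factor is the conjugate of t_zbar; it vanishes
    by the Cauchy-Riemann equations. *)
Lemma dop_chain f p : smoothC V' f -> U p ->
  dop (- 'i) (f \o t) p = lam p * dop (- 'i) f (t p).
Proof.
move=> [fr fi] Up; rewrite dz_transition //; have [e0 e1] := tCR Up.
have dt := smooth_on_diff st Up.
have dfr := smooth_diff fr (tUV Up); have dfi := smooth_diff fi (tUV Up).
have pE k : partialC k (f \o t) p =
    (partial k t p 0 0)%:C * partialC 0 f (t p) + (partial k t p 0 1)%:C * partialC 1 f (t p).
  rewrite -(partial_coord k 0 st Up) -(partial_coord k 1 st Up).
  have pr := partial_comp k dt dfr; have pi := partial_comp k dt dfi.
  apply: (etrans (f_equal2 (@Complex _) pr pi)).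
  exact: complex_lincomb.
have pE1 := etrans (pE 1) (f_equal2
  (fun x y => x%:C * partialC 0 f (t p) + y%:C * partialC 1 f (t p)) e0 e1).
apply: (etrans (f_equal2 (fun x y => (x + - 'i * y) / 2%:R) (pE 0) pE1)).
rewrite /dop.
move: (partial 0 t p 0 0) (partial 0 t p 0 1) (partialC 0 f (t p)) (partialC 1 f (t p)).
move=> a b u v; rewrite mulrA; congr (_ / _).
case: u v => [u u'] [v v']; apply/eqP; rewrite eq_complex /=.
by apply/andP; split; apply/eqP; ring.
Qed.

Variables (B : 'M[R]_6).
Implicit Types G : E -> 'rV[R[i]]_6.

Lemma dopv_chain G p : smoothv V' G -> U p ->
  dopv (- 'i) (G \o t) p = lam p *: dopv (- 'i) G (t p).
Proof.
move=> sG Up; apply/rowP => k; rewrite !mxE.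
exact: (dop_chain (sG k) Up).
Qed.

Definition next_harmonic G p := dopv (- 'i) G p -
  (bilinC B (dopv (- 'i) G p) (conjv (G p)) / bilinC B (G p) (conjv (G p))) *: G p.

(** Differentiating [mu] only adds a multiple of [G'], which the projection removes, and the
    conjugate of [mu] cancels in the projection coefficient. Each step of the recursion thus
    contributes one more factor [lam]. *)
Lemma next_harmonic_chain mu G G' p : smoothC U mu -> smoothv V' G' ->
  smoothv U G -> (forall x, U x -> mu x != 0) ->
  (forall x, U x -> G x = mu x *: G' (t x)) ->
  (forall x, V' x -> bilinC B (G' x) (conjv (G' x)) != 0) -> U p ->
  next_harmonic G p = (mu p * lam p) *: next_harmonic G' (t p).
Proof.
move=> smu sG' sG mu0 GE h0 Up.
have sGt : smoothv U (G' \o t).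
  apply: (smoothv_eq_on oU _ (smoothvZ oU (smoothCV oU mu0 smu) sG)) => x Ux.
  by rewrite GE // scalerA mulVf ?scale1r ?mu0.
have DG : dopv (- 'i) G p = dop (- 'i) mu p *: G' (t p) +
    (mu p * lam p) *: dopv (- 'i) G' (t p).
  rewrite (dopv_eq_on oU _ GE Up) (dopvZ oU _ smu sGt Up) -scalerA.
  by congr (_ + _ *: _); exact: dopv_chain.
rewrite /next_harmonic DG GE //; have := h0 _ (tUV Up).
move: (dopv (- 'i) G' (t p)) (dop (- 'i) mu p) (mu0 p Up) (G' (t p)) => D d m0 x.
move: (mu p) (lam p) m0 => m l m0 h1.
have mc0 : conjc m != 0 by rewrite conjc_eq0.
rewrite conjvZ !(bilinCDl, bilinCZl, bilinCZr) scalerBr !scalerA.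
move: (bilinC B x _) (bilinC B D _) h1 (conjc m) mc0 => h k h1 mc mc0.
apply/rowP => i; rewrite !mxE; field.
by rewrite m0 h1 mc0.
Qed.

End conformal_change.

(** * The cubic differential *)

Section cubic_coefficient.
Variables (R : realType) (B : 'M[R]_6).
Hypothesis sigB : signature33 B.
Implicit Types u v w x : 'rV[R[i]]_6.
Let Bsym := signature33_sym sigB.

(* The component of phi_3 along the real unit normal of the span of phi, phi_1,
   phi_2 and their conjugates, up to a constant factor of modulus 1; expressing
   it by a determinant makes its dependence on the coordinate visible. *)
Definition cubic_coefficient u v w x : R[i] :=
  (Num.sqrt (- \det B))%:C * \det (frame u v w x) /
  (bilinC B v (conjv v) * bilinC B w (conjv w)).

Definition isotropic_frame u v w x : Prop :=
  [/\ bilinC B u u = 1, conjv u = u, bilinC B v v = 0 & bilinC B w w = 0] /\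
  [/\ bilinC B u v = 0, bilinC B u w = 0, bilinC B w v = 0 & bilinC B w (conjv v) = 0] /\
  [/\ bilinC B u x = 0, bilinC B x v = 0, bilinC B x (conjv v) = 0,
      bilinC B x w = 0 & bilinC B x (conjv w) = 0].

Lemma conj_frame u v w x :
  map_mx conjc (frame u v w x) = frame (conjv u) (conjv v) (conjv w) (conjv x).
Proof.
apply/matrixP => i j; rewrite !mxE.
by case: i => [] [|[|[|[|[|[|i]]]]]] //= _; rewrite !mxE.
Qed.

Let s2 : (Num.sqrt (- \det B))%:C * (Num.sqrt (- \det B))%:C = - (\det B)%:C :> R[i].
Proof.
rewrite -rmorphM -expr2 sqr_sqrtr ?rmorphN // oppr_ge0 ltW //.
exact: signature33_det.
Qed.

Lemma cubic_coefficient_sqr u v w x : isotropic_frame u v w x ->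
  bilinC B v (conjv v) != 0 -> bilinC B w (conjv w) != 0 ->
  cubic_coefficient u v w x ^+ 2 = - bilinC B x x.
Proof.
move=> [[uu ur vv ww] [[uv uw wv wvc] X]] v0 w0.
have := det_frame_gram uu Bsym ur (And4 vv ww uv uw) wv wvc X X.
rewrite det_frame_conj /cubic_coefficient.
move: v0 w0 s2; move: (bilinC B v (conjv v)) (bilinC B w (conjv w)) (bilinC B x x) => h k g h0 k0.
move: (\det (frame u v w x)) => D; move: (Num.sqrt (- \det B))%:C => s.
move: (\det B)%:C => d ss DD.
have hk : (h * k) ^+ 2 != 0 by rewrite expf_neq0 ?mulf_neq0.
apply: (mulIf hk); rewrite -exprMn divfK ?mulf_neq0 //.
transitivity ((s * s) * D * D); first by ring.
rewrite ss; transitivity (- (D * d * D)); first by ring.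
by rewrite DD; ring.
Qed.

(** The Gram identity for [y = conjv x], in which the second frame is the complex conjugate of the
    first because [u] is real. *)
Lemma cubic_coefficient_norm u v w x : isotropic_frame u v w x ->
  bilinC B v (conjv v) != 0 -> bilinC B w (conjv w) != 0 ->
  cubic_coefficient u v w x * conjc (cubic_coefficient u v w x) = - bilinC B x (conjv x).
Proof.
move=> [[uu ur vv ww] [[uv uw wv wvc] X]] v0 w0.
have Xc : [/\ bilinC B u (conjv x) = 0, bilinC B (conjv x) v = 0,
    bilinC B (conjv x) (conjv v) = 0, bilinC B (conjv x) w = 0 &
    bilinC B (conjv x) (conjv w) = 0].
  have cj y z : bilinC B y z = 0 -> bilinC B (conjv y) (conjv z) = 0.
    by move=> yz; rewrite -bilinC_conj yz conjc0.
  case: X => ux xv xvc xw xwc; split; try exact: cj.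
  - by rewrite -ur; exact: cj.
  - by rewrite -[v]conjvK; exact: cj.
  - by rewrite -[w]conjvK; exact: cj.
have := det_frame_gram uu Bsym ur (And4 vv ww uv uw) wv wvc X Xc.
have -> : \det (frame u (conjv v) (conjv w) (conjv x)) = conjc (\det (frame u v w x)).
  by rewrite -{1}ur -conj_frame det_map_mx.
rewrite /cubic_coefficient conjcM conjc_inv conjcM conjc_real conjcM.
rewrite !(hermitian_norm_real _ Bsym).
move: v0 w0 s2; move: (bilinC B v (conjv v)) (bilinC B w (conjv w)) (bilinC B x (conjv x)) => h k g h0 k0.
move: (\det (frame u v w x)) => D; move: (Num.sqrt (- \det B))%:C => s.
move: (\det B)%:C => d ss.
move: (conjc D) => Dc DD; have hk : h * k != 0 by rewrite mulf_neq0.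
apply: (mulIf hk); apply: (mulIf hk).
transitivity ((s * s) * D * Dc); first by field; rewrite h0 k0.
rewrite ss; transitivity (- (D * d * Dc)); first by ring.
by rewrite DD; ring.
Qed.

(* phi, phi_1 and its conjugate already span a positive definite 3-space. *)
Lemma h2_not_positive u v w x : isotropic_frame u v w x ->
  0 < bilinC B v (conjv v) -> ~ 0 < bilinC B w (conjv w).
Proof.
move=> [[uu ur vv ww] [[uv uw wv wvc] _]] v0 w0.
(* For the hermitian form these four rows are mutually orthogonal; a positive norm of [w] would make
   them a positive 4-frame. *)
pose U : 'M[R[i]]_(4, 6) := \matrix_(i < 4) nth 0 [:: u; v; conjv v; w] i.
pose d : 'rV[R[i]]_4 := \row_(i < 4) nth 0
  [:: 1; bilinC B v (conjv v); bilinC B v (conjv v); bilinC B w (conjv w)] i.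
apply: (no_positive_4frame sigB (U := U) (d := d)); last first.
  by move=> k; rewrite mxE; case: k => [] [|[|[|[|k]]]] //= _; exact: ltr01.
have sym y z : bilinC B y z = bilinC B z y by exact: bilinC_sym.
have cj y z : bilinC B y z = 0 -> bilinC B (conjv y) (conjv z) = 0.
  by move=> yz; rewrite -bilinC_conj yz conjc0.
have vvc := cj _ _ vv; have uvc := cj _ _ uv; have uwc := cj _ _ uw.
have wcvc := cj _ _ wv; have wcv := cj _ _ wvc.
rewrite ur in uvc uwc; rewrite conjvK in wcv.
have rU k : row k (map_mx conjc U) = conjv (nth 0 [:: u; v; conjv v; w] k).
  by apply/rowP => l; rewrite !mxE.
apply/matrixP => i j; rewrite gram_entry rU rowK !mxE -(inj_eq val_inj).
clear rU cj; case: i j => [i i4] [j j4] /=.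
move: (bilinC B) sym uu vv ww uv uw wv wvc vvc uvc uwc wcvc wcv.
move=> f sym uu vv ww uv uw wv wvc vvc uvc uwc wcvc wcv.
case: i i4 => [|[|[|[|i]]]] //= _; case: j j4 => [|[|[|[|j]]]] //= _;
  rewrite ?conjvK ?ur ?mulr1n ?mulr0n //; by [|rewrite sym].
Qed.

Lemma cubic_coefficient_scale u v w x l : l != 0 ->
  cubic_coefficient u (l *: v) (l ^+ 2 *: w) (l ^+ 3 *: x) =
  l ^+ 3 * cubic_coefficient u v w x.
Proof.
move=> l0; rewrite /cubic_coefficient det_frame_scale !conjvZ !(bilinCZl, bilinCZr).
have lc0 : conjc l != 0 by rewrite conjc_eq0.
have -> : conjc (l ^+ 2) = conjc l ^+ 2 by rewrite !expr2 conjcM.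
rewrite !invfM.
move: (bilinC B v (conjv v))^-1 (bilinC B w (conjv w))^-1 => h k.
move: (\det (frame u v w x)) (Num.sqrt (- \det B))%:C => D s.
move: (conjc l) lc0 => lc lc0.
by field; rewrite l0 lc0.
Qed.

End cubic_coefficient.

(** The constant [a] is 1 for h_1 and -1 for h_2: it makes [e] positive and drops out of the
    logarithmic derivative. The half comes from h = e^(2w) up to sign. *)
Lemma laplacian_half_ln (R : realType) (V : set 'rV[R]_2) (e : 'rV[R]_2 -> R)
    (g : 'rV[R]_2 -> R[i]) (a s t : R[i]) p :
  open V -> smooth_on V (e : 'rV[R]_2 -> R^o) -> (forall x, V x -> 0 < e x) ->
  smoothC V g -> a != 0 -> (forall x, V x -> (e x)%:C = a * g x) -> V p ->
  2%:R * dop t (dop s (fun x => (ln (e x) / 2)%:C)) p =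
  dop t (fun x => dop s g x / g x) p.
Proof.
move=> oV se e0 sg a0 eg Vp.
have sln : smoothC V (fun x => (ln (e x))%:C).
  by apply: smoothC_real => // k; exact: Ck_ln.
have c b := smoothC_cst b oV.
have E x : V x -> dop s (fun x => (ln (e x) / 2)%:C) x = 2^-1 * (dop s g x / g x).
  move=> Vx.
  have E1 : dop s (fun x => (ln (e x) / 2)%:C) x = dop s (fun x => 2^-1 * (ln (e x))%:C) x.
    apply: (dop_eq_on s oV _ Vx) => y _.
    by rewrite rmorphM fmorphV rmorph_nat mulrC.
  rewrite E1 (dopM s oV (c _) sln Vx) dop_cst mul0r add0r (dop_ln s se Vx (e0 x Vx)).
  rewrite (dop_eq_on s oV eg Vx) (dopM s oV (c a) sg Vx) dop_cst mul0r add0r eg //.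
  by rewrite -mulf_div divff // mul1r.
have g0 x : V x -> g x != 0.
  move=> Vx; apply/eqP => gx; have ex0 : (e x)%:C = 0 :> R[i] by rewrite eg // gx mulr0.
  by have := e0 x Vx; rewrite (complexI ex0) ltxx.
have sq : smoothC V (fun x => dop s g x / g x).
  by apply: smoothCM => //; [exact: smoothC_dop|exact: smoothCV].
rewrite (dop_eq_on t oV E Vp) (dopM t oV (c _) sq Vp) dop_cst mul0r add0r.
by rewrite mulrA divff ?pnatr_eq0 // mul1r.
Qed.

(** * Isotropic minimal surfaces: local coordinates, their changes, and the cubic form *)

Section isotropic_surface.
Variables (R : realType) (B : 'M[R]_6) (S : orientedSurface R) (phi : S -> 'rV[R]_6).
Hypotheses (sigB : signature33 B) (hmin : minimal_surface B phi)
  (hiso : isotropy_order2 B phi).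
Let Bsym := signature33_sym sigB.
Implicit Types c : chart R S.
Local Notation FC c := (fun p => toCmx (local_rep phi c p)).
Local Notation P c i := (phi_seq B phi c i).

Lemma isotropic_chart c : holomorphic_coordinate B phi c ->
  isotropic_sequence B (chart_im c) (FC c) (P c 1) (P c 2) (P c 3).
Proof.
move=> hc; have [ac conf] := hc.
have oV : open (chart_im c) by exact: chart_im_open.
have sF := minimal_smooth hmin ac.
have sFC := smoothv_toCmx oV sF.
have FR p : chart_im c p -> conjv (FC c p) = FC c p by move=> _; exact: conjv_real.
have FF p : chart_im c p -> bilinC B (FC c p) (FC c p) = 1.
  by move=> _; rewrite bilinC_real (minimal_in_Q hmin).
have P1E : P c 1 = dopv (- 'i) (FC c) by exact: dz_vecE.
have harm p : chart_im c p ->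
    dopv 'i (P c 1) p = - bilinC B (P c 1 p) (conjv (P c 1 p)) *: FC c p.
  move=> Vp; rewrite P1E.
  have [k kE] := conformal_harmonic oV sF conf Vp (minimal_harmonic hmin ac Vp).
  apply: (etrans kE); congr (_ *: _).
  exact: (harmonic_coefficient oV Bsym sFC FR FF Vp kE).
apply: (IsotropicSequence sFC FR harm FF P1E).
- exact: (harmonic_seqSS B (FC c) 0).
- exact: (harmonic_seqSS B (FC c) 1).
- by move=> p Vp; have [h _ _ _] := hiso hc Vp; exact: h.
- by move=> p Vp; have [_ h _ _] := hiso hc Vp; exact: h.
- by move=> p Vp; have [_ _ h _] := hiso hc Vp; exact: h.
- by move=> p Vp; have [_ _ _ h] := hiso hc Vp; exact: h.
Qed.

Lemma isotropic_frame_chart c p : holomorphic_coordinate B phi c -> chart_im c p ->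
  isotropic_frame B (FC c p) (P c 1 p) (P c 2 p) (P c 3 p).
Proof.
move=> hc Vp; have iso := isotropic_chart hc.
have oV : open (chart_im c) by exact: chart_im_open.
have [[? ? ? ?] ?] := harmonic_sequence_ortho oV Bsym iso Vp.
split; first by split; [exact: (iso_unit iso)|exact: (iso_real iso)|
  exact: (iso_null1 iso)|exact: (iso_null2 iso)].
by split.
Qed.

Section overlap_of_coordinates.
Variables c c' : chart R S.
Hypotheses (hc : holomorphic_coordinate B phi c) (hc' : holomorphic_coordinate B phi c').
Let U := overlap c c'.
Let t := transition c c'.
Let oU : open U. Proof. exact: open_overlap. Qed.
Let oV : open (chart_im c). Proof. exact: chart_im_open. Qed.
Let oV' : open (chart_im c'). Proof. exact: chart_im_open. Qed.

Let UV p : U p -> chart_im c p.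
Proof. by rewrite /U overlapE => -[]. Qed.

Let tV p : U p -> chart_im c' (t p).
Proof. by move=> /overlap_transition[]. Qed.

Let Ft p : U p -> local_rep phi c p = local_rep phi c' (t p).
Proof. by move=> /overlap_transition[_ E]; rewrite /local_rep /= E. Qed.

Let st : smooth_on U t.
Proof. by have [] := atlas_compatible hc.1 hc'.1. Qed.

Lemma jacobian_transition p : U p ->
  'J (local_rep phi c) p = 'J t p *m 'J (local_rep phi c') (t p).
Proof.
move=> Up; have dt := smooth_on_diff st Up.
have dF := smooth_on_diff (minimal_smooth hmin hc.1) (UV Up).
have dF' := smooth_on_diff (minimal_smooth hmin hc'.1) (tV Up).
apply: (etrans _ (jacobian_comp dt dF')); apply/matrixP => i j.
apply: (etrans (jacobian_entry i j dF)).
apply: (etrans _ (esym (jacobian_entry i j (differentiable_comp dt dF')))).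
exact: (congr1 (fun v : 'rV[R]_6 => v 0 j) (partial_eq_on i oU Ft Up)).
Qed.

Lemma conformal_transition p : U p ->
  (partial 1 t p 0 0 = - partial 0 t p 0 1 /\ partial 1 t p 0 1 = partial 0 t p 0 0) /\
  0 < partial 0 t p 0 0 * partial 0 t p 0 0 + partial 0 t p 0 1 * partial 0 t p 0 1.
Proof.
move=> Up; have dt := smooth_on_diff st Up.
have [l l0 lE] := hc.2 _ (UV Up); have [l' l'0 l'E] := hc'.2 _ (tV Up).
have E i j := jacobian_entry i j dt.
have JE : 'J t p = \matrix_(i, j) partial i t p 0 j.
  by apply/matrixP => i j; rewrite E [RHS]mxE.
have TT i j : l *+ (i == j) = l' * \sum_k 'J t p i k * 'J t p j k.
  have := congr1 (fun A : 'M[R]_2 => A i j) lE.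
  rewrite /induced_metric jacobian_transition // trmx_mul !mulmxA.
  rewrite -[_ *m _ *m B](mulmxA) -[_ *m _ *m ('J (local_rep phi c') (t p))^T]mulmxA.
  rewrite -/(induced_metric B (local_rep phi c') (t p)) l'E.
  rewrite mul_mx_scalar -scalemxAl !mxE => <-; congr (_ * _).
  by apply: eq_bigr => k _; rewrite !mxE.
have := (atlas_compatible hc.1 hc'.1).2 _ Up; rewrite -/t JE.
apply: (conformal_jacobian l0 l'0) => i j; rewrite TT; congr (_ * _).
by apply: eq_bigr => k _; rewrite (E i) (E j).
Qed.

Let lam := dop (- 'i) (fun x => toC (t x)).

Let tCR p (Up : U p) := (conformal_transition Up).1.

Let slam : smoothC U lam.
Proof. exact: smoothC_dop oU (smoothC_toC oU st). Qed.

Lemma dz_transition_neq0 p : U p -> lam p != 0.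
Proof.
move=> Up; rewrite /lam (dz_transition st tCR Up).
have := (conformal_transition Up).2; move: (partial 0 t p 0 0) (partial 0 t p 0 1) => a b.
by apply: contraTneq => -[-> ->]; rewrite !mulr0 addr0 ltxx.
Qed.

Let iso := isotropic_chart hc.
Let iso' := isotropic_chart hc'.

Lemma phi1_transition p : U p -> P c 1 p = lam p *: P c' 1 (t p).
Proof.
move=> Up; rewrite (iso_P1 iso) (iso_P1 iso').
have E x : U x -> FC c x = (FC c' \o t) x by move=> Ux; rewrite /= Ft.
rewrite (dopv_eq_on oU (- 'i) E Up).
exact: (dopv_chain st tV tCR (iso_smooth iso') Up).
Qed.

Lemma phi2_transition p : U p -> P c 2 p = lam p ^+ 2 *: P c' 2 (t p).
Proof.
move=> Up; rewrite (iso_P2 iso) (iso_P2 iso').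
apply: (next_harmonic_chain oU st tV tCR slam (smoothv_P1 oV' iso') _ dz_transition_neq0
  phi1_transition (iso_h1 iso') Up).
by move=> k; apply: smoothC_sub UV _; exact: (smoothv_P1 oV iso).
Qed.

Lemma phi3_transition p : U p -> P c 3 p = lam p ^+ 3 *: P c' 3 (t p).
Proof.
move=> Up; rewrite (iso_P3 iso) (iso_P3 iso') exprSr.
apply: (next_harmonic_chain oU st tV tCR (smoothCM oU slam slam) (smoothv_P2 oV' iso') _ _
  phi2_transition (iso_h2 iso') Up).
  by move=> k; apply: smoothC_sub UV _; exact: (smoothv_P2 oV iso).
by move=> x Ux; rewrite mulf_neq0 // dz_transition_neq0.
Qed.

End overlap_of_coordinates.

Definition cubic_form c p : R[i] :=
  cubic_coefficient B (FC c p) (P c 1 p) (P c 2 p) (P c 3 p).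

(** Smoothness must come before holomorphy, because [dzbar_sqr_eq0] passes from q^2 to q only for
    smooth q. A determinant over nonvanishing functions provides it even at zeros of q. *)
Lemma smoothC_cubic_form c : holomorphic_coordinate B phi c ->
  smoothC (chart_im c) (cubic_form c).
Proof.
move=> hc; have iso := isotropic_chart hc.
have oV : open (chart_im c) by exact: chart_im_open.
have s1 := smoothv_P1 oV iso; have s2 := smoothv_P2 oV iso.
have s3 := smoothv_P3 oV iso; have h1 := smoothC_h1 oV iso; have h2 := smoothC_h2 oV iso.
apply: (smoothCM oV); last first.
  apply: (smoothCV oV) (smoothCM oV h1 h2) => p Vp.
  by rewrite mulf_neq0 ?(iso_h1 iso) ?(iso_h2 iso).
apply: (smoothCM oV); first exact: smoothC_cst.
apply: (smoothC_det oV) => i j.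
have sv k : smoothv (chart_im c) (fun p => nth 0 [:: FC c p; P c 1 p; conjv (P c 1 p);
    P c 2 p; conjv (P c 2 p); P c 3 p] k).
  case: k => [|[|[|[|[|[|k]]]]]] /=; [exact: (iso_smooth iso)|exact: s1|
    exact: smoothv_conj|exact: s2|exact: smoothv_conj|exact: s3|].
  (* Past the sixth entry [nth] returns the default 0, a constant field. *)
  by move=> l; rewrite nth_nil; apply: smoothC_eq_on oV _ (smoothC_cst 0 oV) => x _; rewrite mxE.
by apply: (smoothC_eq_on oV) (sv i j) => x _; rewrite mxE.
Qed.

Lemma cubic_form_sqr c p : holomorphic_coordinate B phi c -> chart_im c p ->
  cubic_form c p ^+ 2 = - bilinC B (P c 3 p) (P c 3 p).
Proof.
move=> hc Vp; have iso := isotropic_chart hc.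
exact: (cubic_coefficient_sqr sigB (isotropic_frame_chart hc Vp) (iso_h1 iso Vp)
  (iso_h2 iso Vp)).
Qed.

Lemma cubic_form_norm c p : holomorphic_coordinate B phi c -> chart_im c p ->
  cubic_form c p * conjc (cubic_form c p) = - h_seq B phi c 3 p.
Proof.
move=> hc Vp; have iso := isotropic_chart hc.
exact: (cubic_coefficient_norm sigB (isotropic_frame_chart hc Vp) (iso_h1 iso Vp)
  (iso_h2 iso Vp)).
Qed.

Lemma holomorphic_cubic_form c : holomorphic_coordinate B phi c ->
  holomorphic_on (chart_im c) (cubic_form c).
Proof.
move=> hc; have iso := isotropic_chart hc.
have oV : open (chart_im c) by exact: chart_im_open.
have sq := smoothC_cubic_form hc.
apply: (holomorphic_of_dzbar oV sq); apply: (dzbar_sqr_eq0 oV sq) => p Vp.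
have E x : chart_im c x -> cubic_form c x ^+ 2 = - bilinC B (P c 3 x) (P c 3 x).
  exact: cubic_form_sqr.
have s3 := smoothv_P3 oV iso.
rewrite (dop_eq_on 'i oV E Vp) (dopN 'i oV (smoothC_bilin B oV s3 s3) Vp).
by rewrite (dzbar_P3_sq oV Bsym iso Vp) oppr0.
Qed.

Lemma cubic_form_transition c c' p : holomorphic_coordinate B phi c ->
  holomorphic_coordinate B phi c' -> overlap c c' p ->
  cubic_form c p = cubic_form c' (transition c c' p) *
    dz (fun x => toC (transition c c' x)) p ^+ 3.
Proof.
move=> hc hc' Up; have E1 := phi1_transition hc hc' Up.
have E2 := phi2_transition hc hc' Up; have E3 := phi3_transition hc hc' Up.
have l0 := dz_transition_neq0 hc hc' Up.
have E0 : FC c p = FC c' (transition c c' p).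
  by have [_ E] := overlap_transition Up; rewrite /local_rep /= E.
rewrite dzE mulrC /cubic_form E0 E1 E2 E3.
exact: (cubic_coefficient_scale B _ _ _ _ l0).
Qed.

Lemma h1_chart c p : holomorphic_coordinate B phi c -> chart_im c p ->
  0 < complex.Re (h_seq B phi c 1 p) /\
  h_seq B phi c 1 p = (complex.Re (h_seq B phi c 1 p))%:C.
Proof.
move=> hc Vp; have oV : open (chart_im c) by exact: chart_im_open.
have iso := isotropic_chart hc.
have sF := minimal_smooth hmin hc.1.
have [l l0 lE] := dz_hermitian_norm_gt0 oV sF hc.2 Vp.
have -> : h_seq B phi c 1 p = l%:C by rewrite /h_seq (iso_P1 iso).
by [].
Qed.

(** h_2 is real by symmetry of the form, nonzero by isotropy of order 2, and not positive by the
    signature. *)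
Lemma h2_chart c p : holomorphic_coordinate B phi c -> chart_im c p ->
  0 < - complex.Re (h_seq B phi c 2 p) /\
  h_seq B phi c 2 p = - (- complex.Re (h_seq B phi c 2 p))%:C.
Proof.
move=> hc Vp; have iso := isotropic_chart hc.
have [h1p h1E] := h1_chart hc Vp.
have h10 : 0 < h_seq B phi c 1 p by rewrite h1E ltcR.
have := h2_not_positive sigB (isotropic_frame_chart hc Vp) h10.
have : h_seq B phi c 2 p != 0 := iso_h2 iso Vp.
have : conjc (h_seq B phi c 2 p) = h_seq B phi c 2 p by exact: hermitian_norm_real.
rewrite -[bilinC _ _ _]/(h_seq B phi c 2 p); case: (h_seq B phi c 2 p) => x y [yy].
have -> : y = 0 by lra.
rewrite complexr0 => x0 xn /=; split; last by rewrite rmorphN opprK.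
rewrite oppr_gt0 lt_neqAle leNgt; apply/andP; split.
  by apply: contraNneq x0 => ->.
by apply/negP => x_gt0; apply: xn; rewrite ltcR.
Qed.

End isotropic_surface.

Theorem mainTheorem15 (R : realType) (B : 'M[R]_6) (hB : signature33 B)
    (S : orientedSurface R) (phi : S -> 'rV[R]_6)
    (hmin : minimal_surface B phi) (hiso : isotropy_order2 B phi) :
  exists q : chart R S -> 'rV[R]_2 -> R[i],
    holomorphic_cubic_differential B phi q /\
    forall c : chart R S, holomorphic_coordinate B phi c ->
      exists w1 w2 : 'rV[R]_2 -> R,
        [/\ smooth_on (chart_im c) (w1 : 'rV[R]_2 -> R^o),
            smooth_on (chart_im c) (w2 : 'rV[R]_2 -> R^o) &
            forall p, chart_im c p ->
              [/\ h_seq B phi c 1 p = (expR (2 * w1 p))%:C,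
                  h_seq B phi c 2 p = - (expR (2 * w2 p))%:C,
                  bilinC B (phi_seq B phi c 3 p) (phi_seq B phi c 3 p) = - q c p ^+ 2,
                  2%:R * dzbar (dz (fun x => (w1 x)%:C)) p =
                    - (expR (2 * w2 p - 2 * w1 p))%:C - (expR (2 * w1 p))%:C &
                  2%:R * dzbar (dz (fun x => (w2 x)%:C)) p =
                    q c p * (q c p)^* * (expR (- (2 * w2 p)))%:C
                    + (expR (2 * w2 p - 2 * w1 p))%:C]].
Proof.
have Bsym := signature33_sym hB.
exists (cubic_form B phi); split.
  split=> [c hc|c c' hc hc' p Up]; first exact: holomorphic_cubic_form.
  exact: cubic_form_transition.
move=> c hc; have iso := isotropic_chart hB hmin hiso hc.
have oV : open (chart_im c) by exact: chart_im_open.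
have sh1 : smoothC (chart_im c) (h_seq B phi c 1) := smoothC_h1 oV iso.
have sh2 : smoothC (chart_im c) (h_seq B phi c 2) := smoothC_h2 oV iso.
pose e1 p := complex.Re (h_seq B phi c 1 p).
pose e2 p := - complex.Re (h_seq B phi c 2 p).
have e1P p : chart_im c p -> 0 < e1 p /\ h_seq B phi c 1 p = (e1 p)%:C.
  exact: h1_chart.
have e2P p : chart_im c p -> 0 < e2 p /\ h_seq B phi c 2 p = - (e2 p)%:C.
  exact: h2_chart.
have se1 : smooth_on (chart_im c) (e1 : 'rV[R]_2 -> R^o) by case: sh1.
have se2 : smooth_on (chart_im c) (e2 : 'rV[R]_2 -> R^o).
  exact: smooth_onN oV sh2.1.
have e1E x : chart_im c x -> (e1 x)%:C = 1 * h_seq B phi c 1 x.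
  by move=> /e1P[_ ->]; rewrite mul1r.
have e2E x : chart_im c x -> (e2 x)%:C = - 1 * h_seq B phi c 2 x.
  by move=> /e2P[_ ->]; rewrite mulN1r opprK.
have m1 : - 1 != 0 :> R[i] by rewrite oppr_eq0 oner_neq0.
have slog (e : 'rV[R]_2 -> R) : smooth_on (chart_im c) (e : 'rV[R]_2 -> R^o) ->
    (forall p, chart_im c p -> 0 < e p) ->
    smooth_on (chart_im c) ((fun p => ln (e p) / 2) : 'rV[R]_2 -> R^o).
  by move=> se e0 k; apply: CkM => //; [exact: Ck_ln|exact: Ck_cst].
have explog (e : 'rV[R]_2 -> R) p : 0 < e p -> expR (2 * (ln (e p) / 2)) = e p.
  by move=> e0; rewrite mulrC divfK // lnK.
(* These solve e^(2 w_1) = h_1 and e^(2 w_2) = - h_2. *)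
exists (fun p => ln (e1 p) / 2), (fun p => ln (e2 p) / 2); split.
- by apply: slog => // p /e1P[].
- by apply: slog => // p /e2P[].
move=> p Vp; have [e10 h1E] := e1P p Vp; have [e20 h2E] := e2P p Vp.
have q2 := cubic_form_sqr hB hmin hiso hc Vp.
have qq := cubic_form_norm hB hmin hiso hc Vp.
(* The signs in h_3 / h_2 - h_2 / h_1 for h_3 = - a b with a b = |q|^2, h_2 = - x and h_1 = y. *)
have neg_quotients (a b x y : R[i]) : - (a * b) / - x - - x / y = a * b / x + x / y.
  by rewrite invrN mulrNN mulNr opprK.
have L1 := @laplacian_half_ln R (chart_im c) e1 (h_seq B phi c 1) 1 (- 'i) 'i p oV se1
  (fun x Vx => (e1P x Vx).1) sh1 (oner_neq0 _) e1E Vp.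
have L2 := @laplacian_half_ln R (chart_im c) e2 (h_seq B phi c 2) (-1) (- 'i) 'i p oV se2
  (fun x Vx => (e2P x Vx).1) sh2 m1 e2E Vp.
have K1 : dop 'i (fun x => dop (- 'i) (h_seq B phi c 1) x / h_seq B phi c 1 x) p =
    h_seq B phi c 2 p / h_seq B phi c 1 p - h_seq B phi c 1 p.
  exact: (dzbar_dz_log_h1 oV Bsym iso Vp).
have K2 : dop 'i (fun x => dop (- 'i) (h_seq B phi c 2) x / h_seq B phi c 2 x) p =
    h_seq B phi c 3 p / h_seq B phi c 2 p - h_seq B phi c 2 p / h_seq B phi c 1 p.
  exact: (dzbar_dz_log_h2 oV Bsym iso Vp).
have r1 : (e2 p * (e1 p)^-1)%:C = (e2 p)%:C / (e1 p)%:C.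
  by rewrite (rmorphM (real_complex R)) (fmorphV (real_complex R)).
have r2 : ((e2 p)^-1)%:C = (e2 p)%:C^-1 by rewrite (fmorphV (real_complex R)).
rewrite expRD !expRN !explog // r1 r2.
split=> //.
- by rewrite q2 opprK.
- by rewrite dzE dzbarE; apply: (etrans L1); rewrite K1 h1E h2E mulNr.
- rewrite dzE dzbarE; apply: (etrans L2); rewrite K2 h1E h2E.
  have {}qq : h_seq B phi c 3 p = - (cubic_form B phi c p * conjc (cubic_form B phi c p)).
    by rewrite qq opprK.
  rewrite qq; exact: neg_quotients.
Qed.
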